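(* Let $p$ be a prime and let $G = H_1 \times \ldots \times H_r$ be a non-trivial finite direct product of finitely generated pro-$p$ groups $H_j$ of positive rank gradient. For $1 \le j \le r$, set $\alpha_j = \mathrm{hdim}_G^{\mathcal{F}}(H_j)$, with respect to the Frattini series $\mathcal{F}$ of $G$. Then $G$ has normal Hausdorff spectrum $$\mathrm{hspec}_\trianglelefteq^{\mathcal{F}}(G) = \Big\{ \sum\nolimits_{j \in J} \alpha_j \;\Big|\; J \subseteq \{1,\ldots,r\} \Big\}$$ with respect to $\mathcal{F}$.
   Context: Subgroups of pro-$p$ groups are understood to be closed and generation is topological. For a pro-$p$ group $H$, $d(H)$ denotes the minimal number of topological generators. The rank gradient of a finitely generated pro-$p$ group $G$ is $\mathrm{RG}(G) = \inf_{H} \frac{d(H)-1}{|G:H|}$, where $H$ runs over all open subgroups of $G$; $G$ has positive rank gradient if $\mathrm{RG}(G)>0$. A filtration of a finitely generated infinite pro-$p$ group $G$ is a descending chain $\mathcal{S}\colon G_i$, $i\in\mathbb{N}_0$, of open normal subgroups with trivial intersection. The Hausdorff dimension of a closed subgroup $H\le G$ with respect to $\mathcal{S}$ is $$\mathrm{hdim}_G^{\mathcal{S}}(H) = \liminf_{i\to\infty} \frac{\log_p |HG_i:G_i|}{\log_p |G:G_i|}.$$ The normal Hausdorff spectrum is $\mathrm{hspec}_\trianglelefteq^{\mathcal{S}}(G) = \{\mathrm{hdim}_G^{\mathcal{S}}(N) \mid N \text{ a closed normal subgroup of } G\}$. The Frattini series $\mathcal{F}$ of $G$ is $\Phi_0(G)=G$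 and $\Phi_i(G) = [\Phi_{i-1}(G),\Phi_{i-1}(G)]\,\Phi_{i-1}(G)^p$ for $i\ge1$. *)

(* Defs.v *)
From HB Require Import structures.
From mathcomp Require Import all_boot all_order all_algebra finmap.
From mathcomp Require Import all_classical all_reals all_analysis.

Set Implicit Arguments.
Unset Strict Implicit.
Unset Printing Implicit Defensive.

Import Order.TTheory GRing.Theory Num.Theory.

Local Open Scope classical_set_scope.
Local Open Scope group_scope.

HB.mixin Record Topological_isTopGroup G of Topological G & Group G := {
  mulg_continuous : continuous (fun x : G * G => x.1 * x.2) ;
  invg_continuous : continuous (fun x : G => x^-1)
}.

#[short(type="topGroupType")]
HB.structure Definition TopGroup :=
  {G of Topological G & Group G & Topological_isTopGroup G}.

(* The direct product of a family of topological groups: the componentwise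
   group law on the library's [prod_topology]. *)
Section DirectProduct.
Variables (I : Type) (H : I -> topGroupType).

Local Notation P := (prod_topology H).
Implicit Types x y z : P.

Definition dprod_one : P := fun i => 1.
Definition dprod_inv x : P := fun i => (x i)^-1.
Definition dprod_mul x y : P := fun i => x i * y i.

Fact dprod_mulA : associative dprod_mul.
Proof. by move=> x y z; apply: functional_extensionality_dep => i; exact: mulgA. Qed.
Fact dprod_mul1 : left_id dprod_one dprod_mul.
Proof. by move=> x; apply: functional_extensionality_dep => i; exact: mul1g. Qed.
Fact dprod_mulr1 : right_id dprod_one dprod_mul.
Proof. by move=> x; apply: functional_extensionality_dep => i; exact: mulg1. Qed.
Fact dprod_mulV : left_inverse dprod_one dprod_inv dprod_mul.
Proof. by move=> x; apply: functional_extensionality_dep => i; exact: mulVg. Qed.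
Fact dprod_mulrV : right_inverse dprod_one dprod_inv dprod_mul.
Proof. by move=> x; apply: functional_extensionality_dep => i; exact: mulgV. Qed.

HB.instance Definition _ := isGroup.Build P
  dprod_mulA dprod_mul1 dprod_mulr1 dprod_mulV dprod_mulrV.

Fact dprod_continuousP (T : topologicalType) (f : T -> P) :
  (forall i, continuous (fun t => f t i)) -> continuous f.
Proof.
move=> fc t; apply/cvg_sup => i.
by apply: (@continuous_comp_initial _ _ _ (fun g : P => g i) f); exact: fc.
Qed.

Fact dprod_proj_continuous i : continuous (fun x : P => x i).
Proof.
move=> x; have /cvg_sup/(_ i) xi : x --> x by exact: cvg_id.
apply: (cvg_trans (cvg_app (fun x : P => x i) xi)).
exact: (@initial_continuous _ _ (fun x : P => x i)).
Qed.

Fact dprod_mul_continuous : continuous (fun u : P * P => u.1 * u.2).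
Proof.
apply: dprod_continuousP => i u.
apply: (@continuous_comp (P * P)%type (H i * H i)%type (H i)
  (fun v => (v.1 i, v.2 i)) (fun v => v.1 * v.2)); last exact: mulg_continuous.
apply: cvg_pair.
- exact: (@continuous_comp (P * P)%type P (H i) fst (fun x => x i)
    u (@cvg_fst _ _ _ _ _) (@dprod_proj_continuous i u.1)).
- exact: (@continuous_comp (P * P)%type P (H i) snd (fun x => x i)
    u (@cvg_snd _ _ _ _ _) (@dprod_proj_continuous i u.2)).
Qed.

Fact dprod_inv_continuous : continuous (fun x : P => x^-1).
Proof.
apply: dprod_continuousP => i x.
exact: (@continuous_comp P (H i) (H i) (fun y => y i) (@monoid.inv (H i)) x
  (@dprod_proj_continuous i x) (@invg_continuous (H i) (x i))).
Qed.

HB.instance Definition _ := Topological_isTopGroup.Build P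
  dprod_mul_continuous dprod_inv_continuous.

Definition dprod_factor (j : I) : set P := [set x | forall i, i <> j -> x i = 1].

End DirectProduct.

Section Subgroups.
Variable G : topGroupType.
Implicit Types A B K : set G.

Definition subgroup A :=
  [/\ A 1, (forall x y, A x -> A y -> A (x * y)) & (forall x, A x -> A x^-1)].

Definition normal_subgroup A := subgroup A /\ (forall x y, A x -> A (x ^ y)).

(* The subgroup topologically generated by A. *)
Definition top_gen A : set G :=
  smallest (fun B => closed B /\ subgroup B) A.

Definition setmul A B : set G := [set x * y | x in A & y in B].

(* The index |A : B| for B a subgroup of A, with value 0 if it is infinite. *)
Definition gindex A B : nat :=
  #|` fset_set [set [set a * b | b in B] | a in A]|%fset.

Definition comm_subgroup A B : set G :=
  top_gen [set [~ x, y] | x in A & y in B].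

Definition pow_subgroup n A : set G := top_gen [set x ^+ n | x in A].

Fixpoint frattini (p i : nat) : set G :=
  if i is k.+1 then
    setmul (comm_subgroup (frattini p k) (frattini p k))
           (pow_subgroup p (frattini p k))
  else setT.

End Subgroups.

(* A profinite group is a compact Hausdorff topological group whose open
   subgroups form a base of neighbourhoods of 1; it is pro-p if moreover all
   its open normal subgroups have p-power index. *)
Definition profinite (G : topGroupType) :=
  [/\ compact [set: G], hausdorff_space G &
      forall U : set G, nbhs 1 U ->
        exists K : set G, [/\ open K, subgroup K & K `<=` U]].

Definition pro_p (p : nat) (G : topGroupType) :=
  profinite G /\
  forall N : set G, open N -> normal_subgroup N ->
    exists n : nat, gindex [set: G] N = (p ^ n)%N.

Definition finitely_generated (G : topGroupType) :=
  exists s : seq G, top_gen [set` s] = [set: G].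

Local Open Scope ereal_scope.

(* d(K), with value +oo when K is not topologically finitely generated. *)
Definition min_gens (R : realType) (G : topGroupType) (K : set G) : \bar R :=
  ereal_inf [set (size s)%:R%:E | s in [set s : seq G | top_gen [set` s] = K]].

Definition rank_gradient (R : realType) (G : topGroupType) : \bar R :=
  ereal_inf [set (min_gens R K - 1) / (gindex [set: G] K)%:R%:E
            | K in [set K : set G | open K /\ subgroup K]].

Local Close Scope ereal_scope.
Local Open Scope ring_scope.

Definition logb (R : realType) (p n : nat) : R := ln n%:R / ln p%:R.

Definition hdim (R : realType) (p : nat) (G : topGroupType)
    (S : nat -> set G) (A : set G) : R :=
  limn_inf (fun i => logb R p (gindex (setmul A (S i)) (S i))
                     / logb R p (gindex [set: G] (S i))).

Definition normal_hspec (R : realType) (p : nat) (G : topGroupType)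
    (S : nat -> set G) : set R :=
  [set hdim R p S N | N in [set N : set G | closed N /\ normal_subgroup N]].

Arguments normal_hspec R p {G} S.

(* Main.v *)
(* Write x_i for the index of the i-th Frattini subgroup of a factor H.  A
   subgroup W of index n in H is generated by O(n) elements (Schreier) and by at
   least 1 + c n elements, where c > 0 is the rank gradient; as |W : Phi(W)| is
   exponential in the number of generators, ln x_{i+1} lies between two
   positive multiples of x_i.

   If M is an infinite normal subgroup of H, then M Phi_i(H) has index
   y_i = x_i / q_i with q_i tending to infinity, and the Schreier bound in H / M
   gives ln y_{i+1} = O(y_i) = o(x_i) = o(ln x_{i+1}): M has full dimension in H.
   Two sequences with the growth of x_i either have asymptotically equivalent
   logarithms or one logarithm dominates the other, so the shares
   ln x^j_i / sum_k ln x^k_i of the factors converge; this makes the lower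
   limits additive.

   Finally let N be normal in the product.  The commutators of N with H_j lie in
   N meet H_j, so if this intersection is finite then the projection of N to H_j
   is virtually central in H_j; a group of positive rank gradient has no
   infinite central subgroup, so the projection is finite too.  Hence N has the
   dimension of the product of those H_j onto which it projects with infinite
   image. *)
From HB Require Import structures.
Require Import Defs.
From mathcomp Require Import all_boot all_order all_algebra finmap.
From mathcomp Require Import all_fingroup all_solvable.
From mathcomp Require Import all_classical all_reals all_analysis.
From mathcomp Require Import ring lra.

Set Implicit Arguments.
Unset Strict Implicit.
Unset Printing Implicit Defensive.

Import Order.TTheory GRing.Theory Num.Theory.
Import numFieldNormedType.Exports.

Local Open Scope classical_set_scope.
Local Open Scope card_scope.
Local Open Scope group_scope.

(** * Cosets and indices *)

Section Index.
Variable G : topGroupType.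
Implicit Types (A B C D K M N U V W Z : set G) (x y z : G).

Lemma subgroup1 A : subgroup A -> A 1.
Proof. by case. Qed.

Lemma subgroupM A x y : subgroup A -> A x -> A y -> A (x * y).
Proof. by case=> _ AM _; exact: AM. Qed.

Lemma subgroupV A x : subgroup A -> A x -> A x^-1.
Proof. by case=> _ _; exact. Qed.

Lemma subgroupVl A x : subgroup A -> A x^-1 -> A x.
Proof. by move=> sA /(subgroupV sA); rewrite invgK. Qed.

Lemma subgroupMl A x y : subgroup A -> A x -> A (x * y) -> A y.
Proof.
move=> sA Ax Axy; rewrite -(mulKg x y); apply: subgroupM => //.
exact: subgroupV.
Qed.

Lemma subgroupMr A x y : subgroup A -> A y -> A (x * y) -> A x.
Proof.
move=> sA Ay Axy; rewrite -(mulgK y x); apply: subgroupM => //.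
exact: subgroupV.
Qed.

Lemma subgroupX A x n : subgroup A -> A x -> A (x ^+ n).
Proof.
move=> sA Ax; elim: n => [|n IH]; first exact: subgroup1.
by rewrite expgS; apply: subgroupM.
Qed.

Lemma subgroupJ A x y : subgroup A -> A x -> A y -> A (x ^ y).
Proof.
by move=> sA Ax Ay; rewrite conjgE; do 2?[apply: subgroupM => //]; apply: subgroupV.
Qed.

Lemma subgroupR A x y : subgroup A -> A x -> A y -> A [~ x, y].
Proof.
by move=> sA Ax Ay; apply: subgroupM => //;
  [exact: subgroupV | exact: subgroupJ].
Qed.

Lemma subgroupT : subgroup [set: G].
Proof. by []. Qed.

Lemma subgroupI A B : subgroup A -> subgroup B -> subgroup (A `&` B).
Proof.
move=> [A1 AM AV] [B1 BM BV]; split=> //.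
- by move=> x y [? ?] [? ?]; split; [exact: AM | exact: BM].
- by move=> x [? ?]; split; [exact: AV | exact: BV].
Qed.

(** Finiteness is recorded apart from [gindex], which takes the value 0 at infinite index and so
    bounds nothing by itself. *)
Definition fin_index A B := finite_set [set [set a * b | b in B] | a in A].

(** The two halves of a transversal, kept apart: a covering family bounds an index from above, a
    separated one from below. Covering representatives may lie outside [A]. *)
Definition covers (T : Type) (t : T -> G) A B :=
  forall a, A a -> exists i, B ((t i)^-1 * a).

Definition separated (T : Type) (t : T -> G) A B :=
  (forall i, A (t i)) /\ (forall i j, B ((t i)^-1 * t j) -> i = j).

Lemma eq_lcoset B x y : subgroup B ->
  [set x * b | b in B] = [set y * b | b in B] <-> B (x^-1 * y).
Proof.
move=> sB; split=> [xy|Bxy].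
  have : [set y * b | b in B] y by exists 1; [exact: subgroup1 | rewrite mulg1].
  by rewrite -xy => -[b Bb <-]; rewrite mulKg.
apply/seteqP; split=> _ [b Bb <-].
  exists ((x^-1 * y)^-1 * b); first by apply: subgroupM => //; exact: subgroupV.
  by rewrite invgM invgK !mulgA mulgV mul1g.
exists (x^-1 * y * b); first exact: subgroupM.
by rewrite !mulgA mulgV mul1g.
Qed.

Lemma card_setT_finType (T : finType) : [set: T] #= `I_#|T|.
Proof.
apply: (@card_eq_trans _ _ _ _ [set: 'I_#|T|]); last by rewrite card_eq_sym card_II.
rewrite (_ : setT = enum_val @` [set: 'I_#|T|]); last first.
  by apply/seteqP; split=> // x _; exists (enum_rank x); rewrite ?enum_rankK.
by apply: inj_card_eq; apply: in2W; exact: enum_val_inj.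
Qed.

Lemma gindex_le_card (T : finType) (t : T -> G) A B : subgroup B ->
  covers t A B -> fin_index A B /\ (gindex A B <= #|T|)%N.
Proof.
move=> sB tAB.
have sub : [set [set a * b | b in B] | a in A] `<=`
    (fun i => [set t i * b | b in B]) @` [set: T].
  by move=> _ [a Aa <-]; have [i Bi] := tAB _ Aa; exists i => //; apply/eq_lcoset.
have le : [set [set a * b | b in B] | a in A] #<= `I_#|T|.
  apply: card_le_trans (subset_card_le sub) _.
  apply: card_le_trans (card_image_le _ _) _.
  by have /card_eqPle[] := card_setT_finType T.
by split; [apply/finite_set_leP; exists #|T| | exact: geq_card_fset_set].
Qed.

Lemma card_le_gindex (T : finType) (t : T -> G) A B : subgroup B ->
  fin_index A B -> separated t A B -> (#|T| <= gindex A B)%N.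
Proof.
move=> sB fAB [tA tB]; apply: leq_card_fset_set => //.
apply: (@card_le_trans _ _ _ [set: T]).
  by have /card_eqPle[] := card_setT_finType T.
apply: (@card_le_trans _ _ _ ((fun i => [set t i * b | b in B]) @` [set: T])).
  have /card_eqPle[] // : ((fun i => [set t i * b | b in B]) @` [set: T]) #= [set: T].
  by apply: inj_card_eq => i j _ _ /(eq_lcoset _ _ sB) /tB.
by apply: subset_card_le => _ [i _ <-]; exists (t i).
Qed.

Lemma gindex_transversal A B : subgroup B -> fin_index A B ->
  exists t : 'I_(gindex A B) -> G, separated t A B /\ covers t A B.
Proof.
move=> sB fAB; set n := gindex A B.
have En : [set [set a * b | b in B] | a in A] #= `I_n.
  by have /finite_setP[m Am] := fAB; rewrite /n /gindex (card_fset_set Am).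
have /card_set_bijP[f [fA finj fsurj]] : [set: 'I_n] #=
    [set [set a * b | b in B] | a in A].
  by apply: card_eq_trans (card_esym En); rewrite card_eq_sym card_II.
have /choice[t tP] i : exists x, A x /\ [set x * b | b in B] = f i.
  by have [x Ax xE] := fA i Logic.I; exists x.
exists t; split; first split.
- by move=> i; case: (tP i).
- move=> i j /(eq_lcoset _ _ sB); rewrite (tP i).2 (tP j).2 => fij.
  by apply: finj => //; rewrite inE.
- move=> a Aa.
  have [|i _ fi] := fsurj [set a * b | b in B]; first by exists a.
  by exists i; apply/eq_lcoset => //; rewrite (tP i).2.
Qed.

Lemma gindex_card (T : finType) (t : T -> G) A B : subgroup B ->
  separated t A B -> covers t A B -> gindex A B = #|T|.
Proof.
move=> sB sep cov; have [fAB le] := gindex_le_card sB cov.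
by apply/eqP; rewrite eqn_leq le; exact: card_le_gindex fAB sep.
Qed.

Lemma fin_index_le A A' B : A `<=` A' -> fin_index A' B -> fin_index A B.
Proof. by move=> AA'; apply: sub_finite_set; exact: image_subset. Qed.

Lemma gindex_le A A' B : subgroup B -> A `<=` A' -> fin_index A' B ->
  (gindex A B <= gindex A' B)%N.
Proof.
move=> sB AA' fA'; have [t [[tA tB] _]] :=
  gindex_transversal sB (fin_index_le AA' fA').
rewrite -[X in (X <= _)%N]card_ord; apply: (@card_le_gindex _ t) => //.
by split=> // i; exact/AA'.
Qed.

Lemma fin_index_sub A B C : subgroup B -> subgroup C -> C `<=` B ->
  fin_index A C -> fin_index A B.
Proof.
move=> sB sC CB fAC; have [t [_ tc]] := gindex_transversal sC fAC.
have /(gindex_le_card sB)[] // : covers t A B.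
by move=> a /tc[i Ci]; exists i; exact: CB.
Qed.

(** Products of representatives of [B] in [A] with representatives of [C] in [B] form a transversal
    of [C] in [A]. *)
Lemma gindex_mul A B C : subgroup A -> subgroup B -> subgroup C ->
  C `<=` B -> B `<=` A -> fin_index A B -> fin_index B C ->
  fin_index A C /\ gindex A C = (gindex A B * gindex B C)%N.
Proof.
move=> sA sB sC CB BA fAB fBC.
have [t [[tA tB] tc]] := gindex_transversal sB fAB.
have [u [[uA uB] uc]] := gindex_transversal sC fBC.
pose v (ij : 'I_(gindex A B) * 'I_(gindex B C)) := t ij.1 * u ij.2.
have vc : covers v A C.
  move=> a /tc[i Bi]; have [j Cj] := uc _ Bi; exists (i, j).
  by rewrite /v invgM -mulgA.
split; first exact: (gindex_le_card sC vc).1.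
rewrite (gindex_card sC _ vc) ?card_prod ?card_ord //; split.
  by move=> ij; apply: subgroupM => //; exact/BA.
move=> [i j] [i' j']; rewrite /v /= => Cij.
have ii' : i = i'.
  apply: tB; have := CB _ Cij; rewrite invgM !mulgA => /(subgroupMr sB (uA _)).
  by rewrite -mulgA; apply: subgroupMl => //; exact: subgroupV.
rewrite {}ii' in Cij *; congr pair; apply: uB.
by move: Cij; rewrite invgM -!mulgA mulKg.
Qed.

Lemma gindex_gt0 A B : subgroup B -> A !=set0 -> fin_index A B ->
  (0 < gindex A B)%N.
Proof.
move=> sB [a Aa] fAB; have [t [_ tc]] := gindex_transversal sB fAB.
by have [i _] := tc _ Aa; apply: leq_trans (ltn_ord i).
Qed.

Lemma gindex_gt1 A B x : subgroup A -> subgroup B -> fin_index A B ->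
  A x -> ~ B x -> (1 < gindex A B)%N.
Proof.
move=> sA sB fAB Ax nBx.
rewrite -card_bool; apply: (@card_le_gindex _ (fun b : bool => if b then x else 1)) => //.
split; first by case=> //; exact: subgroup1.
case; case=> //=; rewrite ?invg1 ?mul1g ?mulg1 // => ?; exfalso; apply: nBx => //.
exact: subgroupVl.
Qed.

End Index.

(** * Topological groups *)

Section Topology.
Variable G : topGroupType.
Implicit Types (A B C D K M N U V W Z : set G) (x y z : G).

Lemma mulgl_continuous x : continuous (fun y : G => x * y).
Proof.
move=> y; apply: (@continuous_comp G (G * G)%type G (fun y => (x, y))
  (fun u => u.1 * u.2)); last exact: mulg_continuous.
by apply: cvg_pair; [exact: cvg_cst | exact: cvg_id].
Qed.

Lemma mulgr_continuous x : continuous (fun y : G => y * x).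
Proof.
move=> y; apply: (@continuous_comp G (G * G)%type G (fun y => (y, x))
  (fun u => u.1 * u.2)); last exact: mulg_continuous.
by apply: cvg_pair; [exact: cvg_id | exact: cvg_cst].
Qed.

Lemma conjg_continuous x : continuous (fun y : G => y ^ x).
Proof.
move=> y; apply: (@continuous_comp G G G (fun y => y * x) (fun y => x^-1 * y)).
  exact: mulgr_continuous.
exact: mulgl_continuous.
Qed.

Lemma closed_continuous (X Y : topologicalType) (f : X -> Y) (D : set Y) :
  continuous f -> closed D -> closed [set x | D (f x)].
Proof. by move=> fc; apply: preimage_closed => x _; exact: fc. Qed.

Lemma open_continuous (X Y : topologicalType) (f : X -> Y) (D : set Y) :
  continuous f -> open D -> open [set x | D (f x)].
Proof. by move=> fc; apply: open_comp => x _; exact: fc. Qed.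

Lemma subgroup_nbhs_open A : subgroup A -> nbhs 1 A -> open A.
Proof.
move=> sA A1; rewrite openE => x Ax.
have Ax1 : nbhs x [set y | A (x^-1 * y)].
  by apply: mulgl_continuous; rewrite mulVg.
rewrite /interior; apply: filterS Ax1 => y /=.
by apply: subgroupMl => //; exact: subgroupV.
Qed.

Lemma open_subgroup_nbhs A : subgroup A -> open A -> nbhs 1 A.
Proof. by move=> sA oA; apply: open_nbhs_nbhs; split=> //; exact: subgroup1. Qed.

Lemma open_subgroup_sup A B : open A -> subgroup A -> subgroup B -> A `<=` B ->
  open B.
Proof.
move=> oA sA sB AB; apply: subgroup_nbhs_open => //.
exact: filterS AB (open_subgroup_nbhs sA oA).
Qed.

Lemma open_subgroup_closed A : subgroup A -> open A -> closed A.
Proof.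
move=> sA oA; rewrite -(setCK A); apply: open_closedC; rewrite openE => x nAx.
have Ax1 : nbhs x [set y | A (x^-1 * y)].
  by apply: mulgl_continuous; rewrite mulVg; exact: open_subgroup_nbhs.
rewrite /interior; apply: filterS Ax1 => y /= Axy Ay; apply: nAx.
by apply: subgroupVl => //; apply: subgroupMr Axy.
Qed.

Lemma covers_closed (T : finType) (t : T -> G) A B : subgroup A ->
  B `<=` A -> (forall i, A (t i)) -> covers t A B -> closed B -> closed A.
Proof.
move=> sA BA tA tc cB.
rewrite (_ : A = \bigcup_(i in [set: T]) [set y | B ((t i)^-1 * y)]).
  apply: closed_bigcup => [|i _]; first exact: finite_finset.
  by apply: closed_continuous => //; exact: mulgl_continuous.
apply/seteqP; split=> [a /tc[i Bi]|y [i _ /= /BA Ay]]; first by exists i.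
by apply: subgroupMl Ay => //; exact: subgroupV.
Qed.

(** Removing from the open set [A] the finitely many closed cosets of [B] other than [B] itself
    leaves [B]. *)
Lemma fin_index_open A B : subgroup A -> subgroup B -> B `<=` A ->
  fin_index A B -> open A -> closed B -> open B.
Proof.
move=> sA sB BA fAB oA cB; have [t [[tA _] tc]] := gindex_transversal sB fAB.
pose F := \bigcup_(i in [set i | ~ B (t i)]) [set y | B ((t i)^-1 * y)].
have cF : closed F.
  apply: closed_bigcup => [|i _]; first exact: finite_finset.
  by apply: closed_continuous => //; exact: mulgl_continuous.
rewrite (_ : B = A `&` ~` F); first by apply: openI => //; exact: closed_openC.
apply/seteqP; split=> [x Bx|x [Ax nFx]].
  split; [exact: BA | move=> [i nBi /= Bi]; apply: nBi].
  by apply: subgroupVl => //; apply: subgroupMr Bi.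
have [i Bi] := tc _ Ax; apply: contrapT => nBx; apply: nFx; exists i => //= Bti.
by apply: nBx; apply: subgroupMl Bi => //; exact: subgroupV.
Qed.

Lemma compact_open_fin_index A : compact [set: G] -> subgroup A -> open A ->
  fin_index [set: G] A.
Proof.
move=> cG sA oA.
(* Compactness by open covers is formulated for pointed spaces; the base point is 1. *)
pose T : ptopologicalType := HB.pack_for ptopologicalType G (isPointed.Build G 1).
have : @cover_compact T [set: G] by rewrite -compact_cover.
move=> /(_ G [set: G] (fun x => [set y | A (x^-1 * y)])) [].
- by move=> x _; apply: open_continuous => //; exact: mulgl_continuous.
- by move=> x _; exists x => //=; rewrite mulVg; exact: subgroup1.
move=> D _ cov.
have cv : covers (val : D -> G) [set: G] A; last exact: (gindex_le_card sA cv).1.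
by move=> x _; have [y yD /= Ay] := cov x Logic.I; exists [` yD]%fset.
Qed.

(** * Topologically generated subgroups *)

Lemma top_gen_sub A : A `<=` top_gen A.
Proof. exact: sub_smallest. Qed.

Lemma top_gen_min A B : closed B -> subgroup B -> A `<=` B -> top_gen A `<=` B.
Proof. by move=> cB sB; apply: smallest_sub. Qed.

Lemma top_gen_subgroup A : subgroup (top_gen A).
Proof.
split=> [B [[_ sB] _]|x y Ax Ay B [[cB sB] AB]|x Ax B [[cB sB] AB]].
- exact: subgroup1.
- by apply: subgroupM => //; [apply: Ax | apply: Ay].
- by apply: subgroupV => //; apply: Ax.
Qed.

Lemma top_gen_closed A : closed (top_gen A).
Proof.
rewrite /top_gen /smallest; by apply: closed_bigI => B [[cB _] _].
Qed.

Lemma top_genS A B : A `<=` B -> top_gen A `<=` top_gen B.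
Proof.
move=> AB; apply: top_gen_min; [exact: top_gen_closed|exact: top_gen_subgroup|].
by apply: subset_trans AB _; exact: top_gen_sub.
Qed.

End Topology.

(** * Profinite groups *)

Section Profinite.
Variable G : topGroupType.
Implicit Types (A B C D K M N U V W Z : set G) (x y z : G).

Lemma setmul_subl A B : subgroup B -> A `<=` setmul A B.
Proof. by move=> sB x Ax; exists x => //; exists 1; [exact: subgroup1|rewrite mulg1]. Qed.

Lemma setmul_subr A B : subgroup A -> B `<=` setmul A B.
Proof. by move=> sA x Bx; exists 1; [exact: subgroup1|exists x => //; rewrite mul1g]. Qed.

Lemma setmul_min A B C : subgroup C -> A `<=` C -> B `<=` C -> setmul A B `<=` C.
Proof.
by move=> sC hA hB _ [x Ax [y By <-]]; apply: subgroupM => //; [exact: hA|exact: hB].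
Qed.

Lemma setmulS A A' B B' : A `<=` A' -> B `<=` B' -> setmul A B `<=` setmul A' B'.
Proof. by move=> hA hB _ [x /hA Ax [y /hB By <-]]; exists x => //; exists y. Qed.

Lemma setmul_subgroup A B : subgroup A -> subgroup B ->
  (forall a b, A a -> B b -> B (b ^ a)) -> subgroup (setmul A B).
Proof.
move=> sA sB AB; split.
- by apply: setmul_subl => //; exact: subgroup1.
- move=> _ _ [a Aa [b Bb <-]] [a' Aa' [b' Bb' <-]]; exists (a * a').
    exact: subgroupM.
  exists (b ^ a' * b'); first by apply: subgroupM => //; exact: AB.
  by rewrite conjgE !mulgA mulgK.
- move=> _ [a Aa [b Bb <-]]; exists a^-1; first exact: subgroupV.
  exists (b^-1 ^ a^-1); last by rewrite conjgE invgK mulKg invgM.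
  by apply: AB; exact: subgroupV.
Qed.

Lemma setmul_normal A N : subgroup A -> normal_subgroup N -> subgroup (setmul A N).
Proof. by move=> sA [sN nN]; apply: setmul_subgroup => // a b _; exact: nN. Qed.

Lemma setmul_normal2 N M : normal_subgroup N -> normal_subgroup M ->
  normal_subgroup (setmul N M).
Proof.
move=> nN nM; split; first exact: setmul_normal nN.1 nM.
move=> _ y [n Nn [m Mm <-]]; rewrite conjMg.
by exists (n ^ y); [exact: nN.2 | exists (m ^ y) => //; exact: nM.2].
Qed.

Lemma setmul_closed A B : compact [set: G] -> hausdorff_space G ->
  closed A -> closed B -> closed (setmul A B).
Proof.
move=> cG hG cA cB.
have kA : compact A by apply: subclosed_compact cG _.
have kB : compact B by apply: subclosed_compact cG _.
rewrite (_ : setmul A B = (fun u : G * G => u.1 * u.2) @` (A `*` B)); last first.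
  apply/seteqP; split; first by move=> _ [x Ax [y By <-]]; exists (x, y).
  by move=> _ [[x y] [/= Ax By] <-]; exists x => //; exists y.
apply: compact_closed => //; apply: continuous_compact; last exact: compact_setX.
by apply: continuous_subspaceT => u; exact: mulg_continuous.
Qed.

Lemma normal_core K : compact [set: G] -> open K -> subgroup K ->
  exists N, [/\ open N, normal_subgroup N & N `<=` K].
Proof.
move=> cG oK sK; pose N := [set x | forall y, K (x ^ y)].
have nN : normal_subgroup N.
  split; last by move=> x y Nx z; rewrite -conjgM; exact: Nx.
  split=> [y|x y Nx Ny z|x Nx z]; first by rewrite conj1g; exact: subgroup1.
  - by rewrite conjMg; exact: subgroupM.
  - by rewrite conjVg; exact: subgroupV.
exists N; split=> //; last by move=> x /(_ 1); rewrite conjg1.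
have [t [_ tc]] := gindex_transversal sK (compact_open_fin_index cG sK oK).
apply: subgroup_nbhs_open nN.1 _.
(* Conjugation by elements of [K] preserves [K], so the finitely many conditions at the [t i]
   already define the core. *)
have : nbhs 1 [set x | forall i, K (x ^ t i)].
  apply: filter_forall => i; apply: conjg_continuous.
  by rewrite conj1g; exact: open_subgroup_nbhs.
apply: filterS => x Kx y; have [i Ki] := tc y Logic.I.
rewrite -(mulVKg (t i) y) conjgM; exact: subgroupJ.
Qed.

Lemma profinite_normal U : profinite G -> nbhs 1 U ->
  exists K, [/\ open K, normal_subgroup K & K `<=` U].
Proof.
move=> [cG _ H] /H[K [oK sK KU]].
have [N [oN nN NK]] := normal_core cG oK sK.
by exists N; split=> //; exact: subset_trans KU.
Qed.

(* [G / K] is realized as a group of permutations of the cosets of [K], so that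
   finite group theory applies to it. *)
Lemma finite_quotient K : compact [set: G] -> open K -> normal_subgroup K ->
  exists f : G -> {perm 'I_(gindex [set: G] K)},
  [/\ {morph f : x y / x * y}, (forall x, f x = 1 <-> K x) &
      #|[set s | `[< exists x, f x = s >]]%SET| = gindex [set: G] K].
Proof.
move=> cG oK nK; have sK := nK.1; set n := gindex _ _.
have [t [[_ tB] tc]] := gindex_transversal sK (compact_open_fin_index cG sK oK).
have /choice[c cP] x : exists i, K ((t i)^-1 * x) by exact: tc.
have c_eq x y : c x = c y <-> K (x^-1 * y).
  have E : x^-1 * y = ((t (c x))^-1 * x)^-1 * ((t (c x))^-1 * y).
    by rewrite invgM invgK !mulgA mulgK.
  split=> [xy|Kxy].
    rewrite E; apply: subgroupM => //; first by apply: subgroupV.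
    by rewrite xy.
  apply: tB.
  rewrite (_ : _ * _ = ((t (c x))^-1 * x) * (x^-1 * y) * ((t (c y))^-1 * y)^-1).
    by apply: subgroupM (subgroupV _ _) => //; exact: subgroupM.
  by rewrite invgM invgK !mulgA !mulgK.
have ct i : c (t i) = i.
  by apply: tB; exact: cP.
(* The inverse turns this into a right action, matching the order of composition of permutations. *)
pose h x (i : 'I_n) := c (x^-1 * t i).
have hM x y i : h (x * y) i = h y (h x i).
  apply/c_eq; rewrite (_ : _ * _ = ((t (h x i))^-1 * (x^-1 * t i))^-1).
    by apply: subgroupV => //; exact: cP.
  by rewrite !gnorm.
have h_eq x y : K (y^-1 * x) -> h x =1 h y.
  move=> Kyx i; apply/c_eq; rewrite (_ : _ * _ = (y^-1 * x) ^ (y^-1 * t i)).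
    exact: nK.2.
  by rewrite conjgE !gnorm.
have hinj x : injective (h x).
  move=> i j /c_eq; rewrite invgM invgK -!mulgA mulVKg; exact: tB.
exists (fun x => perm (hinj x)); split.
- by move=> x y; apply/permP => i; rewrite permM !permE.
- move=> x; split=> [/permP/(_ (c 1))|Kx].
    rewrite permE perm1 /h -{2}(ct (c 1)) => /c_eq Kx.
    have := nK.2 _ (t (c 1))^-1 Kx.
    by rewrite conjgE !gnorm.
  apply/permP => i; rewrite permE perm1 -[RHS]ct; rewrite (h_eq x 1) ?gnorm //.
  by rewrite /h !gnorm.
- rewrite -[RHS]card_ord -cardsT.
  have -> : [set s | `[< exists x, perm (hinj x) = s >]]%SET =
     [set perm (hinj (t i)) | i in [set: 'I_n]]%SET.
    apply/setP => s; rewrite !finset.inE; apply/asboolP/imsetP => [[x <-]|[i _ ->]].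
      exists (c x) => //; apply/permP => i; rewrite !permE; apply: h_eq; exact: cP.
    by exists (t i).
  rewrite card_imset // => i j /permP/(_ (c 1)); rewrite !permE => /c_eq.
  move=> Kij; apply/esym/tB; have := nK.2 _ ((t (c 1))^-1 * t j) Kij.
  by rewrite conjgE !gnorm.
Qed.

End Profinite.

(** * The Frattini subgroup *)

Section Frattini.
Variables (p : nat) (G : topGroupType).
Implicit Types (A B C D K M N U V W Z : set G) (x y z : G).

(** One step of the Frattini series, for an arbitrary [W]: [frattini p i.+1] unfolds to
    [frat p (frattini p i)]. *)
Definition frat W := setmul (comm_subgroup W W) (pow_subgroup p W).

Lemma frat_comm W x y : W x -> W y -> frat W [~ x, y].
Proof.
move=> Wx Wy; apply: setmul_subl; first exact: top_gen_subgroup.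
by apply: top_gen_sub; exists x => //; exists y.
Qed.

Lemma frat_pow W x : W x -> frat W (x ^+ p).
Proof.
move=> Wx; apply: setmul_subr; first exact: top_gen_subgroup.
by apply: top_gen_sub; exists x.
Qed.

Lemma frat_min W B : closed B -> subgroup B ->
  (forall x y, W x -> W y -> B [~ x, y]) -> (forall x, W x -> B (x ^+ p)) ->
  frat W `<=` B.
Proof.
move=> cB sB BR BX; apply: setmul_min => //; apply: top_gen_min => //.
  by move=> _ [x Wx [y Wy <-]]; exact: BR.
by move=> _ [x Wx <-]; exact: BX.
Qed.

Lemma frat_sub W : closed W -> subgroup W -> frat W `<=` W.
Proof.
move=> cW sW; apply: frat_min => // [x y Wx Wy|x Wx].
  exact: subgroupR.
exact: subgroupX.
Qed.

Lemma conjg_subgroup A a : subgroup A -> subgroup [set x : G | A (x ^ a)].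
Proof.
move=> sA; split=> [|x y Ax Ay|x Ax] /=.
- by rewrite conj1g; exact: subgroup1.
- by rewrite conjMg; exact: subgroupM.
- by rewrite conjVg; exact: subgroupV.
Qed.

(** The elements whose conjugate by [a] lies in [top_gen A] form a closed subgroup containing
    [A]. *)
Lemma top_gen_conj A a : (forall x, A x -> A (x ^ a)) ->
  forall x, top_gen A x -> top_gen A (x ^ a).
Proof.
move=> AJ; apply: (top_gen_min (B := [set x | top_gen A (x ^ a)])).
- by apply: closed_continuous (@top_gen_closed _ _); exact: conjg_continuous.
- by apply: conjg_subgroup; exact: top_gen_subgroup.
- by move=> x Ax; apply: top_gen_sub; exact: AJ.
Qed.

Lemma comm_subgroup_conj W a : (forall x, W x -> W (x ^ a)) ->
  forall x, comm_subgroup W W x -> comm_subgroup W W (x ^ a).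
Proof.
move=> WJ; apply: top_gen_conj => _ [x Wx [y Wy <-]]; rewrite conjRg.
by exists (x ^ a); [exact: WJ | exists (y ^ a) => //; exact: WJ].
Qed.

Lemma pow_subgroup_conj W a : (forall x, W x -> W (x ^ a)) ->
  forall x, pow_subgroup p W x -> pow_subgroup p W (x ^ a).
Proof.
move=> WJ; apply: top_gen_conj => _ [x Wx <-]; rewrite conjXg.
by exists (x ^ a) => //; exact: WJ.
Qed.

Lemma frat_conj W a : (forall x, W x -> W (x ^ a)) ->
  forall x, frat W x -> frat W (x ^ a).
Proof.
move=> WJ _ [x Cx [y Py <-]]; rewrite conjMg; exists (x ^ a).
  exact: comm_subgroup_conj.
by exists (y ^ a) => //; exact: pow_subgroup_conj.
Qed.

Lemma frat_subgroup W : closed W -> subgroup W -> subgroup (frat W).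
Proof.
move=> cW sW; apply: setmul_subgroup; [exact: top_gen_subgroup..|].
move=> a b Ca Pb; apply: pow_subgroup_conj => // x Wx.
apply: subgroupJ => //; move: Ca; apply: top_gen_min => // _ [u Wu [v Wv <-]].
exact: subgroupR.
Qed.

Lemma frat_normal W : closed W -> normal_subgroup W -> normal_subgroup (frat W).
Proof.
move=> cW nW; split; first exact: frat_subgroup cW nW.1.
by move=> x y; apply: frat_conj => z; exact: nW.2.
Qed.

Lemma frat_closed W : compact [set: G] -> hausdorff_space G -> closed (frat W).
Proof. by move=> cG hG; apply: setmul_closed => //; exact: top_gen_closed. Qed.

(** Elements of the Frattini subgroup are non-generators: the claim is reduced to a finite quotient
    [G / K], where it is the theorem on finite $p$-groups. *)
Lemma frattini_nongen W D : prime p -> pro_p p G -> closed W -> subgroup W ->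
  closed D -> subgroup D -> D `<=` W -> W `<=` setmul D (frat W) -> W `<=` D.
Proof.
move=> pp [pG pind] cW sW cD sD DW WD x Wx; apply: contrapT => nDx.
have [cG _ _] := pG.
(* As [D] is closed, some coset [x K] misses it. *)
have [|K [oK nK KU]] := @profinite_normal G [set k | ~ D (x * k)] pG.
  apply: (@mulgl_continuous G x 1 (~` D)); rewrite mulg1.
  by apply: open_nbhs_nbhs; split=> //; exact: closed_openC.
have [f [fM fK fG]] := finite_quotient cG oK nK.
have f1 : f 1 = 1 by apply/fK; exact: subgroup1 nK.1.
have fV y : f y^-1 = (f y)^-1.
  by apply: (mulgI (f y)); rewrite -fM !mulgV.
have fX y n : f (y ^+ n) = f y ^+ n.
  by elim: n => [|n IH]; [exact: f1 | rewrite !expgS fM IH].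
pose im (A : set G) := [set s | `[< exists2 y, A y & f y = s >]]%SET.
have imP A y : A y -> f y \in im A by move=> Ay; rewrite finset.inE; apply/asboolP; exists y.
have imG A : subgroup A -> group_set (im A).
  move=> sA; apply/group_setP; split.
    by rewrite -f1; apply: imP; exact: subgroup1.
  move=> s t; rewrite !finset.inE => /asboolP[y Ay <-] /asboolP[z Az <-].
  by apply/asboolP; exists (y * z) => //; exact: subgroupM.
pose P := group (imG _ sW); pose Q := group (imG _ sD).
pose T := group (imG _ (@subgroupT G)).
have pT : p.-group T.
  have [n nE] := pind K oK nK; rewrite /pgroup.
  have -> : #|T| = gindex [set: G] K.
    apply: etrans fG; apply: eq_card => s; rewrite !finset.inE.
    by apply: asbool_equiv_eq; split=> -[y]; exists y.
  by rewrite nE pnatX pnat_id.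
have pP : p.-group P.
  apply: pgroupS pT; apply/fintype.subsetP => s; rewrite !finset.inE => /asboolP[y _ <-].
  by apply/asboolP; exists y.
have sPhi : subgroup [set y | f y \in 'Phi(P)].
  split=> [|u v Pu Pv|u Pu] /=; first by rewrite f1 group1.
    by rewrite fM groupM.
  by rewrite fV groupV.
have fPhi y : frat W y -> f y \in 'Phi(P).
  apply: (frat_min (B := [set y | f y \in 'Phi(P)])) => //.
  (* This preimage contains the open kernel [K], so it is open and therefore closed. *)
  - apply: open_subgroup_closed => //; apply: open_subgroup_sup oK nK.1 sPhi _.
    by move=> k /fK /= ->; exact: group1.
  - move=> u v Wu Wv /=; rewrite /commg /conjg !(fM, fV).
    rewrite (Phi_joing pP); apply: (fintype.subsetP (joing_subl _ _)).
    by apply: mem_commg; exact: imP.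
  - move=> u Wu /=; rewrite fX (Phi_joing pP); apply: (fintype.subsetP (joing_subr _ _)).
    rewrite -[p]expn1; apply: Mho_p_elt; first exact: imP.
    by apply: mem_p_elt pP _; exact: imP.
(* [Q] and ['Phi(P)] together generate [P], so [Q] alone does. *)
have QP : <<Q>> = P :> {set _}.
  apply: Phi_nongen; apply/eqP; rewrite finset.eqEsubset join_subG Phi_sub /=.
  apply/andP; split.
    apply/fintype.subsetP => s; rewrite !finset.inE => /asboolP[y /DW Wy <-].
    by apply/asboolP; exists y.
  apply/fintype.subsetP => s; rewrite finset.inE => /asboolP[y /WD[d Dd [z Fz <-]] <-].
  rewrite fM; apply: groupM; apply: mem_gen; rewrite finset.inE.
    by rewrite imP ?orbT.
  by rewrite fPhi.
have : f x \in (Q : {set _}) by rewrite -(genGid Q) QP; exact: imP.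
rewrite finset.inE => /asboolP[d Dd fd].
apply: (KU (x^-1 * d)); last by rewrite mulKVg.
by apply/fK; rewrite fM fV fd mulVg.
Qed.

End Frattini.

(** * Generators and indices *)

Section Generators.
Variables (p : nat) (G : topGroupType).
Implicit Types (A B C D K M N U V W Z : set G) (x y z : G) (s : seq G).

(* A weak form of Schreier's index formula: the left cosets of [B], the closed
   subgroup generated by the Schreier generators, translated by a transversal
   of [W], form a closed set stable under the generators of [G]. *)
Lemma schreier W s : subgroup W -> open W -> fin_index [set: G] W ->
  top_gen [set` s] = [set: G] ->
  exists s', size s' = (size s * gindex [set: G] W)%N /\ top_gen [set` s'] = W.
Proof.
move=> sW oW fW sG; set n := gindex _ _.
have [t [[_ tB] tc]] := gindex_transversal sW fW.
have /choice[c cP] x : exists i, W ((t i)^-1 * x) by exact: tc.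
pose s' := [seq (t (c (g * t i)))^-1 * (g * t i) | g <- s, i <- enum 'I_n].
exists s'; split; first by rewrite size_allpairs size_enum_ord.
set B := top_gen _; have sB : subgroup B by exact: top_gen_subgroup.
have cB : closed B by exact: top_gen_closed.
have BW : B `<=` W.
  apply: top_gen_min => //; first exact: open_subgroup_closed.
  by move=> _ /= /allpairsP[[g i] [_ _ ->]]; exact: cP.
have s'B g i : g \in s -> B ((t (c (g * t i)))^-1 * (g * t i)).
  move=> gs; apply: top_gen_sub => /=; apply/allpairsP.
  by exists (g, i); rewrite mem_enum.
clearbody B.
pose X := \bigcup_(i in [set: 'I_n]) [set y | B ((t i)^-1 * y)].
have cX : closed X.
  apply: closed_bigcup => [|i _]; first exact: finite_finset.
  by apply: closed_continuous cB; exact: mulgl_continuous.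
(* The elements that map [X] into itself together with their inverses form a closed subgroup; it
   then suffices to treat the generators. *)
have stabX : [set: G] `<=` [set g | forall x, X x -> X (g * x) /\ X (g^-1 * x)].
  rewrite -sG; apply: top_gen_min.
  - rewrite (_ : mkset _ = \bigcap_(x in X)
        ([set g | X (g * x)] `&` [set g | X (g^-1 * x)])); last first.
      by apply/seteqP; split=> g.
    apply: closed_bigI => x _; apply: closedI.
      by apply: closed_continuous => //; exact: mulgr_continuous.
    apply: (@closed_continuous _ _ (fun g => g^-1) [set g | X (g * x)]).
      exact: invg_continuous.
    by apply: closed_continuous => //; exact: mulgr_continuous.
  - split=> [x Xx|g h Hg Hh x Xx|g Hg x Xx]; first by rewrite invg1 mul1g.
      rewrite invgM -!mulgA.
      by split; [exact: (Hg _ (Hh _ Xx).1).1 | exact: (Hh _ (Hg _ Xx).2).2].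
    by rewrite invgK; split; [exact: (Hg _ Xx).2 | exact: (Hg _ Xx).1].
  - move=> g /= gs x [i _ /= Bi]; split.
      exists (c (g * t i)) => //=.
      rewrite (_ : _ * _ = ((t (c (g * t i)))^-1 * (g * t i)) * ((t i)^-1 * x)).
        by apply: subgroupM => //; exact: s'B.
      by rewrite !gnorm.
    set j := c (g^-1 * t i); exists j => //=.
    (* The Schreier generator of [g] at the coset [j] of [g^-1 * t i] ends in the coset [i], so its
       inverse performs the step by [g^-1]. *)
    have cj : c (g * t j) = i.
      apply: tB; rewrite (_ : _ * _ = ((t (c (g * t j)))^-1 * (g * t j)) *
        ((t j)^-1 * (g^-1 * t i))); last by rewrite !gnorm.
      by apply: subgroupM => //; exact: cP.
    have := s'B _ j gs; rewrite cj => Bij.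
    rewrite (_ : _ * _ = ((t i)^-1 * (g * t j))^-1 * ((t i)^-1 * x)).
      by apply: subgroupM => //; exact: subgroupV.
    by rewrite !gnorm.
apply/seteqP; split=> // w Ww.
have [i0 Wi0] := tc 1 Logic.I.
have Xi0 : X (t i0) by exists i0 => //=; rewrite mulVg; exact: subgroup1.
(* Translating [t i0] gives [t i0 * w] in [X]; as [w] is in [W], its coset is still that of [i0],
   which puts [w] into [B]. *)
have [i _ /= Bi] := (stabX (t i0 * w * (t i0)^-1) Logic.I _ Xi0).1.
rewrite mulgVK in Bi.
have ii0 : i = i0.
  apply: tB; apply: (subgroupMr sW Ww); rewrite -mulgA; exact: BW.
by rewrite ii0 mulKg in Bi.
Qed.

(** [W / K] is elementary abelian. Adjoining the generators to [K] one at a time multiplies the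
    index by at most [p], and the result stays closed as a finite union of closed cosets, so it is
    all of [W]. *)
Lemma elementary_index W K s : (0 < p)%N -> subgroup W -> closed K ->
  subgroup K -> K `<=` W -> (forall x y, W x -> W y -> K [~ x, y]) ->
  (forall x, W x -> K (x ^+ p)) -> top_gen [set` s] = W ->
  fin_index W K /\ (gindex W K <= p ^ size s)%N.
Proof.
move=> p0 sW cK sK KW KR KX sE.
suff [B [[cB sB] [KB BW] sB' [fB iB]]] : exists B, [/\ closed B /\ subgroup B,
    K `<=` B /\ B `<=` W, [set` s] `<=` B
    & fin_index B K /\ (gindex B K <= p ^ size s)%N].
  suff <- : B = W by [].
  by apply/seteqP; split=> //; rewrite -sE; apply: top_gen_min.
have : [set` s] `<=` W by rewrite -sE; exact: top_gen_sub.
elim: s {sE} => [_|x s IH sxW].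
  exists K; split; [by []| by split| by move=> x; rewrite /= in_nil|].
  have /(gindex_le_card sK)[] : covers (fun _ : 'I_1 => 1 : G) K K.
    by move=> a Ka; exists ord0; rewrite invg1 mul1g.
  by rewrite card_ord; split.
have [|B [[cB sB] [KB BW] sB' [fB iB]]] := IH.
  by move=> y ys; apply: sxW; rewrite /= inE (ys : is_true _) orbT.
have Wx : W x by apply: sxW; rewrite /= mem_head.
have BJ b w : W w -> B b -> B (b ^ w).
  move=> Ww Bb; rewrite -(mulVKg b (b ^ w)); apply: subgroupM => //.
  by apply: KB; apply: KR => //; exact: BW.
have BX n : B (x ^+ (n * p)).
  by apply: KB; rewrite mulnC expgnA; apply: subgroupX => //; exact: KX.
(* This is the subgroup generated by [x] and [B]: natural exponents suffice because [x ^+ p] lies in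
   [K]. *)
pose B' := [set y | exists n, B ((x ^+ n)^-1 * y)].
have sB'' : subgroup B'.
  split.
  - by exists 0; rewrite expg0 invg1 mulg1; exact: subgroup1.
  - move=> y z [n By] [m Bz]; exists (n + m).
    rewrite (_ : _ * _ = ((x ^+ n)^-1 * y) ^ (x ^+ m) * ((x ^+ m)^-1 * z)).
      by apply: subgroupM => //; apply: BJ => //; exact: subgroupX.
    by rewrite conjgE expgnDr !gnorm.
  (* Modulo [B], the inverse of [x ^+ n] is [x ^+ (n * p.-1)], as the two exponents add up to
     [n * p]. *)
  - move=> y [n By]; exists (n * p.-1)%N.
    rewrite (_ : _ * _ = (((x ^+ n)^-1 * y)^-1) ^ (x ^+ (n * p.-1)) *
                          (x ^+ (n * p))^-1).
      apply: subgroupM => //; last exact: subgroupV.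
      by apply: BJ; [exact: subgroupX | exact: subgroupV].
    have -> : x ^+ (n * p) = x ^+ n * x ^+ (n * p.-1).
      by rewrite -expgnDr -mulnS prednK.
    by rewrite conjgE !gnorm.
have BB' : B `<=` B' by move=> b Bb; exists 0; rewrite expg0 invg1 mul1g.
have cov : covers (fun e : 'I_p => x ^+ e) B' B.
  move=> y [n By]; exists (Ordinal (ltn_pmod n p0)) => /=.
  rewrite (_ : _ * _ = x ^+ (n %/ p * p) * ((x ^+ n)^-1 * y)).
    by apply: subgroupM.
  have -> : x ^+ n = x ^+ (n %% p) * x ^+ (n %/ p * p).
    by rewrite -expgnDr addnC -divn_eq.
  by rewrite !gnorm.
have [fB' iB'] := gindex_le_card sB cov; rewrite card_ord in iB'.
have B'x e : B' (x ^+ e) by exists e; rewrite mulVg; exact: subgroup1.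
exists B'; split.
- by split=> //; apply: covers_closed cov _.
- split; first exact: subset_trans BB'.
  move=> y [n /BW Wy]; apply: subgroupMl Wy => //; apply: subgroupV => //.
  exact: subgroupX.
- move=> y /=; rewrite inE => /orP[/eqP ->|/sB' /BB' //].
  by have := B'x 1%N; rewrite expg1.
- have [? ->] := gindex_mul sB'' sB sK KB BB' fB' fB; split=> //.
  by rewrite expnS leq_mul.
Qed.

(** Starting from [frat p W], each new element outside the subgroup reached so far at least doubles
    it. Once [W] is exhausted, non-generation discards [frat p W] from the generating set. *)
Lemma frattini_generators W : prime p -> pro_p p G -> closed W -> subgroup W ->
  fin_index W (frat p W) ->
  exists s, top_gen [set` s] = W /\ (2 ^ size s <= gindex W (frat p W))%N.
Proof.
move=> pp pG cW sW fW; have [[cG hG _] _] := pG.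
have sF := frat_subgroup p cW sW.
suff [s [sW' s2 sg]] : exists s, [/\ [set` s] `<=` W,
    (2 ^ size s <= gindex W (frat p W))%N & W `<=` top_gen ([set` s] `|` frat p W)].
  exists s; split=> //; apply/seteqP; split; first exact: top_gen_min.
  apply: (@frattini_nongen p) => //; first exact: top_gen_closed.
  - exact: top_gen_subgroup.
  - exact: top_gen_min.
  - apply: subset_trans sg _; apply: top_gen_min.
    + by apply: setmul_closed => //; [exact: top_gen_closed | exact: frat_closed].
    + apply: setmul_subgroup => //; first exact: top_gen_subgroup.
      move=> a b /(top_gen_min cW sW sW') Wa; apply: frat_conj => x Wx.
      exact: subgroupJ.
    + rewrite subUset; split; last by apply: setmul_subr; exact: top_gen_subgroup.
      by apply: subset_trans (@top_gen_sub _ _) _; exact: setmul_subl.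
(* [frat p W] is generalized to any closed subgroup of finite index in [W], for an induction on that
   index. *)
have := @frat_closed p _ W cG hG; have := @frat_sub p _ W cW sW.
move: (frat p W) sF fW => B; have [n] := ubnP (gindex W B).
elim: n B => // n IH B leB sB fB BW cB.
have [WB|/existsNP[x /not_implyP[Wx nBx]]] := pselect (W `<=` B).
  exists [::]; split=> //; last by apply: subset_trans WB _ => x Bx; apply: top_gen_sub; right.
  rewrite expn0; apply: gindex_gt0 => //; exists 1; exact: subgroup1.
pose B' := top_gen (x |` B).
have sB' : subgroup B' by exact: top_gen_subgroup.
have BB' : B `<=` B' by move=> b Bb; apply: top_gen_sub; right.
have B'W : B' `<=` W by apply: top_gen_min => //; rewrite subUset sub1set inE.
have B'x : B' x by apply: top_gen_sub; left.
have fB' := fin_index_sub sB' sB BB' fB.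
have fB'B := fin_index_le B'W fB.
have [_ iE] := gindex_mul sW sB' sB BB' B'W fB' fB'B.
have i2 := gindex_gt1 sB' sB fB'B B'x nBx.
have i1 : (0 < gindex W B')%N by apply: gindex_gt0 => //; exists x.
have [|||||s [sW' s2 sg]] := IH B' => //; last 1 first.
- exists (x :: s); split.
  + by move=> y /=; rewrite inE => /orP[/eqP ->|/sW'].
  + by rewrite /= expnS iE mulnC leq_mul.
  + apply: subset_trans sg _; apply: top_gen_min.
    * exact: top_gen_closed.
    * exact: top_gen_subgroup.
    * rewrite subUset; split.
        by move=> y ys; apply: top_gen_sub; left; rewrite /= inE (ys : is_true _) orbT.
      apply: top_genS; rewrite subUset; split; last by move=> y By; right.
      by move=> _ ->; left; rewrite /= mem_head.
- rewrite ltnS in leB; apply: leq_trans leB; rewrite iE.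
  by rewrite -[X in (X < _)%N]muln1 ltn_pmul2l.
- exact: top_gen_closed.
Qed.

End Generators.

(** * Indices along the Frattini series *)

Section Growth.
Variables (p : nat) (G : topGroupType).
Implicit Types (A B C D K M N U V W Z : set G) (x y z : G) (s : seq G).

(** Among [n] distinct points of [A] there are only finitely many quotients other than 1, and an
    open normal subgroup avoids them all. *)
Lemma infinite_separated A n : profinite G -> infinite_set A ->
  exists (K : set G) (t : 'I_n -> G), [/\ open K, normal_subgroup K & separated t A K].
Proof.
move=> pG /(infinite_set_fset n)[B BA nB]; have [_ hG _] := pG.
pose t (i : 'I_n) := nth (1 : G) B i.
have tinj i j : i <> j -> 1 <> (t i)^-1 * t j.
  move=> ij tij; apply: ij.
  have := congr1 (fun z => t i * z) tij; rewrite /= mulg1 mulVKg => tE.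
  apply/val_inj/eqP; rewrite -(nth_uniq (1 : G) _ _ (fset_uniq B)).
  - by apply/eqP; exact: tE.
  - exact: leq_trans (ltn_ord i) nB.
  - exact: leq_trans (ltn_ord j) nB.
have : nbhs (1 : G) [set k | forall ij : 'I_n * 'I_n,
    ij.1 <> ij.2 -> k <> (t ij.1)^-1 * t ij.2].
  apply: filter_forall => -[i j] /=.
  have [->|ij] := pselect (i = j); first by apply: nearW.
  have : nbhs (1 : G) (~` [set (t i)^-1 * t j]).
    apply: open_nbhs_nbhs; split; last exact: tinj.
    by apply: closed_openC; apply/accessible_closed_set1/hausdorff_accessible.
  by apply: filterS.
move=> /(profinite_normal pG)[K [oK nK KU]]; exists K, t; split=> //; split.
  by move=> i; apply: BA; apply: mem_nth; exact: leq_trans (ltn_ord i) nB.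
by move=> i j /KU /= /(_ (i, j)) /= Kij; apply: contrapT => /Kij.
Qed.

Hypotheses (pp : prime p) (pG : pro_p p G).
Variable s0 : seq G.
Hypothesis s0G : top_gen [set` s0] = [set: G].

Let cG : compact [set: G]. Proof. by case: pG => -[]. Qed.
Let hG : hausdorff_space G. Proof. by case: pG => -[]. Qed.
Local Notation ind A := (gindex [set: G] A).
Local Notation d := (size s0).

Lemma open_fin_index W : subgroup W -> open W -> fin_index [set: G] W.
Proof. exact: compact_open_fin_index. Qed.

(** [schreier] provides [d * |G : W|] generators of [W], and [elementary_index] turns them into an
    index bound. All upper bounds on growth come from here. *)
Lemma open_elementary_index W K : subgroup W -> open W -> closed K ->
  subgroup K -> K `<=` W -> (forall x y, W x -> W y -> K [~ x, y]) ->
  (forall x, W x -> K (x ^+ p)) ->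
  fin_index W K /\ (gindex W K <= p ^ (d * ind W))%N.
Proof.
move=> sW oW cK sK KW KR KX.
have [s [<- sE]] := schreier sW oW (open_fin_index sW oW) s0G.
by apply: elementary_index => //; exact: prime_gt0.
Qed.

Lemma open_frat W : subgroup W -> open W ->
  [/\ fin_index W (frat p W), (gindex W (frat p W) <= p ^ (d * ind W))%N &
      open (frat p W)].
Proof.
move=> sW oW; have cW := open_subgroup_closed sW oW.
have sF := frat_subgroup p cW sW; have FW := @frat_sub p _ W cW sW.
have cF : closed (frat p W) by exact: frat_closed.
have [fF iF] := open_elementary_index sW oW cF sF FW
  (@frat_comm p G W) (@frat_pow p G W).
by split=> //; exact: (fin_index_open sW sF FW fF oW cF).
Qed.

Local Notation Phi := (@frattini G p).

Lemma frattini_open_normal i : open (Phi i) /\ normal_subgroup (Phi i).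
Proof.
elim: i => [|i [oF nF]]; first by split; [exact: openT | split=> //; exact: subgroupT].
split; first by have [] := open_frat nF.1 oF.
by apply: (@frat_normal p G (Phi i)) => //; apply: open_subgroup_closed => //; case: nF.
Qed.

Lemma frattiniS i : Phi i.+1 `<=` Phi i.
Proof.
have [oF nF] := frattini_open_normal i.
by apply: (@frat_sub p G (Phi i) _ nF.1); apply: open_subgroup_closed => //; case: nF.
Qed.

Lemma frattini_le i j : (i <= j)%N -> Phi j `<=` Phi i.
Proof.
move=> /subnK <-; elim: (j - i)%N => // k IH.
by apply: subset_trans IH; exact: frattiniS.
Qed.

Lemma ind_frattiniS i :
  fin_index (Phi i) (Phi i.+1) /\ ind (Phi i.+1) = (ind (Phi i) * gindex (Phi i) (Phi i.+1))%N.
Proof.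
have [oF nF] := frattini_open_normal i; have [oF' nF'] := frattini_open_normal i.+1.
have [fF _ _] := open_frat nF.1 oF; split=> //.
have fT := open_fin_index nF.1 oF.
by have [] := gindex_mul (@subgroupT G) nF.1 nF'.1 (@frattiniS i) (@subsetT _ _) fT fF.
Qed.

Lemma ind_frattini_ub i : (ind (Phi i.+1) <= ind (Phi i) * p ^ (d * ind (Phi i)))%N.
Proof.
have [oF nF] := frattini_open_normal i; have [_ ->] := ind_frattiniS i.
by have [_ le _] := open_frat nF.1 oF; rewrite leq_mul2l le orbT.
Qed.

(* While [Phi i] is not contained in [K], non-generation makes the image of the
   series in [G / K] drop strictly. *)
Lemma frattini_base K : open K -> normal_subgroup K ->
  exists i0, forall i, (i0 <= i)%N -> Phi i `<=` K.
Proof.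
move=> oK nK; have fK := open_fin_index nK.1 oK.
suff [i0 H] : exists i0, Phi i0 `<=` K.
  by exists i0 => i /frattini_le; move/subset_trans; exact.
have fKi i : fin_index (setmul (Phi i) K) K by exact: fin_index_le fK.
have [n] := ubnP (gindex (setmul (Phi 0) K) K); move: (0 : nat).
elim: n => // n IH i; rewrite ltnS => le.
have [|/existsNP[x /not_implyP[Fx nKx]]] := pselect (Phi i `<=` K); first by exists i.
apply: (IH i.+1); apply: leq_trans le.
have [oF nF] := frattini_open_normal i; have [oF' nF'] := frattini_open_normal i.+1.
have cF := open_subgroup_closed nF.1 oF.
have sM := setmul_normal nF.1 nK; have sM' := setmul_normal nF'.1 nK.
have M'M : setmul (Phi i.+1) K `<=` setmul (Phi i) K by exact: setmulS (@frattiniS i) _.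
have KM' : K `<=` setmul (Phi i.+1) K by apply: setmul_subr; case: nF'.
have fMM' := fin_index_sub sM' nK.1 KM' (fKi i).
have [_ ->] := gindex_mul sM sM' nK.1 KM' M'M fMM' (fKi i.+1).
suff [y My nM'y] : exists2 y, setmul (Phi i) K y & ~ setmul (Phi i.+1) K y.
  rewrite -[X in (X < _)%N]mul1n ltn_pmul2r; first exact: gindex_gt1 My nM'y.
  by apply: gindex_gt0 (nK.1) _ (fKi _); exists 1; exact: subgroup1 sM'.
(* Otherwise [Phi i] lies in [Phi i.+1 K], hence is the product of its intersection with [K] and
   [Phi i.+1]; non-generation then puts [Phi i] inside [K], against the choice of [x]. *)
apply: contrapT => nex.
have MM' : Phi i `<=` setmul (Phi i.+1) K.
  move=> y Fy; apply: contrapT => nM'; apply: nex; exists y => //.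
  exact: setmul_subl nK.1 _ Fy.
apply: nKx; have : Phi i `<=` Phi i `&` K; last by move=> /(_ _ Fx)[].
apply: (frattini_nongen pp pG cF nF.1) => //.
- by apply: closedI => //; apply: open_subgroup_closed => //; case: nK.
- by apply: subgroupI => //; [case: nF | case: nK].
- move=> y Fy; have [u F'u [k Kk uk]] := MM' _ Fy.
  have Fu := @frattiniS i _ F'u; have Fk : Phi i k.
    by apply: (subgroupMl nF.1 Fu); rewrite uk.
  (* The factors are swapped by a conjugation, since non-generation wants the part in [K] on the
     left. *)
  exists (k ^ u^-1); last by exists u => //; rewrite -conjgCV.
  by split; [exact: nF.2 | exact: nK.2].
Qed.

(** * The Frattini series modulo a normal subgroup *)

Lemma normal_frattini_open M i : normal_subgroup M ->
  open (setmul M (Phi i)) /\ normal_subgroup (setmul M (Phi i)).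
Proof.
move=> nM; have [oF nF] := frattini_open_normal i.
have nMF := setmul_normal2 nM nF; split=> //.
by apply: open_subgroup_sup oF nF.1 nMF.1 _; apply: setmul_subr; case: nM.
Qed.

(** The bound [ind_frattini_ub] for [G / M], carried out inside [G] so that no quotient topological
    group has to be formed. *)
Lemma ind_normal_frattini_ub M i : normal_subgroup M ->
  (ind (setmul M (Phi i.+1)) <=
   ind (setmul M (Phi i)) * p ^ (d * ind (setmul M (Phi i))))%N.
Proof.
move=> nM; have [oW nW] := normal_frattini_open i nM.
have [oK nK] := normal_frattini_open i.+1 nM.
have [oF nF] := frattini_open_normal i; have [oF' nF'] := frattini_open_normal i.+1.
set W := setmul M (Phi i) in oW nW *; set K := setmul M (Phi i.+1) in oK nK *.
have KW : K `<=` W by apply: setmulS => //; exact: frattiniS.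
have MK : M `<=` K by exact: setmul_subl nF'.1.
have F'K : Phi i.+1 `<=` K by apply: setmul_subr; case: nM.
(* Congruence modulo [M]. Every element of [W] is congruent to one of [Phi i], so commutators and
   [p]-th powers of [W] are congruent to elements of [Phi i.+1] and lie in [K]. *)
pose e x y := M (x^-1 * y).
have eM x x' y y' : e x x' -> e y y' -> e (x * y) (x' * y').
  rewrite /e => xx yy.
  rewrite (_ : _ * _ = (x^-1 * x') ^ y * (y^-1 * y')); last by rewrite conjgE !gnorm.
  by apply: subgroupM => //; [case: nM | exact: nM.2].
have eV x y : e x y -> e x^-1 y^-1.
  rewrite /e => xy; rewrite (_ : _ * _ = ((x^-1 * y)^-1) ^ x^-1).
    by apply: nM.2; apply: subgroupV => //; case: nM.
  by rewrite conjgE !gnorm.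
have eX x y n : e x y -> e (x ^+ n) (y ^+ n).
  move=> xy; elim: n => [|n IH]; last by rewrite !expgS; exact: eM.
  by rewrite /e mulVg; apply: subgroup1; case: nM.
have eK x y : K x -> e x y -> K y.
  by move=> Kx /MK Kxy; apply: subgroupMl Kxy; [case: nK|apply: subgroupV => //; case: nK].
have We y : W y -> exists2 x, Phi i x & e x y.
  move=> [m Mm [x Fx <-]]; exists x => //.
  by rewrite /e -conjgE; exact: nM.2.
have [|||fK iK] := @open_elementary_index W K nW.1 oW _ nK.1 KW.
- by apply: open_subgroup_closed => //; case: nK.
- move=> x y /We[x' Fx' ex] /We[y' Fy' ey].
  apply: (@eK [~ x', y']); first by apply: F'K; exact: (@frat_comm p G (Phi i)).
  by rewrite /commg /conjg; do ![apply: (eM)|apply: (eV)|done].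
- move=> x /We[x' Fx' ex]; apply: (@eK (x' ^+ p)); last exact: eX.
  by apply: F'K; exact: (@frat_pow p G (Phi i)).
have [_ ->] := gindex_mul (@subgroupT G) nW.1 nK.1 KW (@subsetT _ _)
  (open_fin_index nW.1 oW) fK.
by rewrite leq_mul2l iK orbT.
Qed.

Lemma ind_normal_frattini M i : normal_subgroup M ->
  fin_index (setmul M (Phi i)) (Phi i) /\
  ind (Phi i) = (ind (setmul M (Phi i)) * gindex (setmul M (Phi i)) (Phi i))%N.
Proof.
move=> nM; have [oW nW] := normal_frattini_open i nM.
have [oF nF] := frattini_open_normal i.
have fF : fin_index (setmul M (Phi i)) (Phi i).
  exact: fin_index_le (@subsetT _ _) (open_fin_index nF.1 oF).
have FM : Phi i `<=` setmul M (Phi i) by apply: setmul_subr; case: nM.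
by have [] := gindex_mul (@subgroupT G) nW.1 nF.1 FM (@subsetT _ _)
  (open_fin_index nW.1 oW) fF.
Qed.

(** Points separated modulo an open normal [K] stay separated modulo [Phi i] as soon as [Phi i] is
    contained in [K]. *)
Lemma infinite_gindex A n : infinite_set A ->
  exists i0, forall i, (i0 <= i)%N -> (n <= gindex (setmul A (Phi i)) (Phi i))%N.
Proof.
move=> /(infinite_separated n pG.1)[K [t [oK nK [tA tK]]]].
have [i0 H] := frattini_base oK nK; exists i0 => i /H FK.
have [oF nF] := frattini_open_normal i.
rewrite -[X in (X <= _)%N](card_ord n).
apply: (card_le_gindex (t := t) nF.1).
  exact: fin_index_le (@subsetT _ _) (open_fin_index nF.1 oF).
split=> [j|j k /FK]; last exact: tK.
exact: setmul_subl nF.1 _ (tA j).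
Qed.

(* Put [W = V Z].  The quotient of [W] by [K = Z^p frat V] is elementary abelian,
   so the Schreier bound for [W] controls [|W : K|], while the power map gives
   [|K : frat V| <= |Z : V meet Z| = |W : V|]. *)
Lemma center_frat_index Z V : subgroup Z -> (forall z x, Z z -> z * x = x * z) ->
  open V -> normal_subgroup V ->
  (gindex V (frat p V) <= p ^ (d * ind (setmul V Z)))%N.
Proof.
move=> sZ zZ oV nV; set W := setmul V Z.
have nZ : normal_subgroup Z by split=> // z y Zz; rewrite conjgE (zZ z y Zz) mulKg.
(* Central factors drop out of commutators, so those of [W] are already commutators of elements of
   [V]. *)
have commZ a b z : Z z -> [~ a * z, b] = [~ a, b].
  move=> Zz; rewrite /commg /conjg invgM -!mulgA (zZ z b Zz).
  rewrite [LHS](_ : _ = z^-1 * (a^-1 * (b^-1 * (a * b)) * z)); last by rewrite !gnorm.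
  by rewrite -(zZ z _ Zz) mulKg.
have nW : normal_subgroup W by exact: setmul_normal2.
have VW : V `<=` W by exact: setmul_subl.
have oW : open W by exact: open_subgroup_sup oV nV.1 nW.1 VW.
have cV : closed V by apply: open_subgroup_closed => //; case: nV.
set F := frat p V.
have [fVF _ oF] := open_frat nV.1 oV.
have nF : normal_subgroup F by exact: frat_normal.
have FV : F `<=` V by apply: frat_sub => //; case: nV.
pose Zp := [set x ^+ p | x in Z].
have sZp : subgroup Zp.
  split; first by exists 1; [exact: subgroup1|exact: expg1n].
    move=> _ _ [x Zx <-] [y Zy <-]; exists (x * y); first exact: subgroupM.
    by rewrite expgMn //; exact: zZ.
  by move=> _ [x Zx <-]; exists x^-1; [exact: subgroupV | rewrite expVgn].
set K := setmul Zp F.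
have ZpZ : Zp `<=` Z by move=> _ [x Zx <-]; exact: subgroupX.
have ZW : Z `<=` W by apply: setmul_subr; case: nV.
have sK : subgroup K by exact: setmul_normal.
have FK : F `<=` K by exact: setmul_subr.
have KW : K `<=` W.
  apply: setmul_min nW.1 _ _; first by move=> x /ZpZ /ZW.
  by move=> x /FV /VW.
have oK : open K by exact: open_subgroup_sup oF nF.1 sK FK.
have [|||fWK iWK] := @open_elementary_index W K nW.1 oW _ sK KW.
- exact: open_subgroup_closed.
- move=> _ _ [v Vv [z Zz <-]] [v' Vv' [z' Zz' <-]].
  rewrite commZ // -invgR commZ // invgR; apply: FK; exact: frat_comm.
- move=> _ [v Vv [z Zz <-]]; rewrite expgMn; last by rewrite /commute (zZ z v Zz).
  apply: subgroupM => //; first by apply: FK; exact: frat_pow.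
  by apply: setmul_subl nF.1 _ _; exists z.
have fWV : fin_index W V.
  exact: fin_index_le (@subsetT _ _) (open_fin_index nV.1 oV).
have [t [[tW tV] tc]] := gindex_transversal nV.1 fWV.
have /choice[u uP] j : exists u, Z u /\ V ((t j)^-1 * u).
  have [v Vv [z Zz vz]] := tW j; exists z; split=> //.
  by rewrite -vz -(zZ z v Zz) invgM mulgVK; apply: subgroupV => //; case: nV.
(* Elements of [Z] congruent modulo [V] have [p]-th powers congruent modulo [F], so the
   representatives [u j] of [W / V] suffice. *)
have cov : covers (fun j => u j ^+ p) K F.
  move=> _ [_ [z Zz <-] [f Ff <-]]; have [j Vj] := tc _ (ZW _ Zz); exists j.
  have [Zu Vu] := uP j; rewrite mulgA; apply: subgroupM => //; first by case: nF.
  rewrite -expVgn -expgMn; last by rewrite /commute (zZ z _ Zz).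
  apply: frat_pow; rewrite (_ : _ * _ = ((t j)^-1 * u j)^-1 * ((t j)^-1 * z)).
    by apply: subgroupM => //; [case: nV | apply: subgroupV => //; case: nV].
  by rewrite !gnorm.
have [fKF iKF] := gindex_le_card nF.1 cov; rewrite card_ord in iKF.
have [_ E1] := gindex_mul nW.1 nV.1 nF.1 FV VW fWV fVF.
have [_ E2] := gindex_mul nW.1 sK nF.1 FK KW fWK fKF.
have q0 : (0 < gindex W V)%N by apply: gindex_gt0 nV.1 _ fWV; exists 1; exact: subgroup1 nW.1.
(* The index [|W : F|] factors through [V] and through [K]; as [|K : F| <= |W : V|], the factor
   [|W : V|] cancels. *)
rewrite -(leq_pmul2l q0) -E1 E2 mulnC; exact: leq_mul.
Qed.

End Growth.

(** * Growth rates *)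

Section GrowthRates.
Local Open Scope ring_scope.
Variable R : realType.
Implicit Types x y : nat -> R.

Lemma ln_le_id (u : R) : 0 < u -> ln u <= u.
Proof. by move=> /ln_sublinear/ltW. Qed.

(** The exponential lower bound makes [ln (x i)] at least linear in [i], so bounded errors in
    logarithms become negligible; the other clause is the two-sided estimate of one logarithm by the
    preceding term. *)
Definition growth x :=
  (forall i, 2 ^+ i <= x i) /\
  exists A B : R, [/\ 0 < A, 0 < B & forall i, A * x i <= ln (x i.+1) <= B * x i].

Lemma growth_gt0 x i : growth x -> 0 < x i.
Proof. by case=> gx _; apply: lt_le_trans (gx i); rewrite exprn_gt0. Qed.

Lemma growth_ln x i : growth x -> i%:R * ln 2 <= ln (x i).
Proof.
move=> gx; rewrite mulr_natl -lnXn //; rewrite ler_ln ?posrE ?exprn_gt0 //.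
  by case: gx.
exact: growth_gt0.
Qed.

Lemma growth_ln_gt0 x i : growth x -> 0 < ln (x i.+1).
Proof.
move=> gx; apply: lt_le_trans (growth_ln i.+1 gx).
by rewrite mulr_gt0 ?ltr0n // ln_gt0 // ltr1n.
Qed.

Lemma geom_ge_nat i : (i.+1%:R : R) <= 2 ^+ i.
Proof. by rewrite -natrX ler_nat ltn_expl. Qed.

Lemma cvg0_inv_bound (u : nat -> R) (C : R) :
  (\forall i \near \oo, 0 <= u i <= C / i%:R) -> u @ \oo --> 0.
Proof.
move=> uC; apply/cvgrPdist_le => e e0; near=> i.
have /andP[u0 uCi] : 0 <= u i <= C / i%:R by near: i.
rewrite sub0r normrN ger0_norm // (le_trans uCi) //.
have i0 : (0 < i)%N by near: i; exact: nbhs_infty_gt.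
rewrite ler_pdivrMr ?ltr0n // mulrC -ler_pdivrMr //.
by near: i; exact: nbhs_infty_ger.
Unshelve. all: by end_near. Qed.

(* Once [x i >= K * y i], the growth rates force [x i.+1 >= y i.+1 ^+ 2], which
   is much larger than [K * y i.+1], and the gap keeps widening. *)
Lemma growth_dominate x y : growth x -> growth y ->
  exists2 K : R, 0 < K &
    (forall i0, exists2 i, (i0 <= i)%N & K * y i <= x i) ->
    (fun i => ln (y i) / ln (x i)) @ \oo --> 0.
Proof.
move=> gx gy; have [_ [A [B' [A0 _ xAB]]]] := gx.
have [_ [A' [B [_ B0 yAB]]]] := gy.
have x0 i := growth_gt0 i gx; have y0 i := growth_gt0 i gy.
(* Chosen so that [A * (K * y i) = 2 * (B * y i)], which is at least twice [ln (y i.+1)]. *)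
pose K := 2 * B / A; have K0 : 0 < K by rewrite divr_gt0 // mulr_gt0.
exists K => // H.
(* From [N] on, [y i.+1 >= 2 ^+ i.+1 >= i.+2 >= K], so the square of [y i.+1] exceeds
   [K * y i.+1]. *)
have [N _ HN] := nbhs_infty_ger K; have [i1 Ni1 Ki1] := H N.
have step i : (N <= i)%N -> K * y i <= x i -> y i.+1 ^+ 2 <= x i.+1.
  move=> _ Kx; rewrite -ler_ln ?posrE ?exprn_gt0 // lnXn // -mulr_natl.
  have /andP[_ yB] := yAB i; have /andP[xA _] := xAB i.
  apply: le_trans xA; apply: (@le_trans _ _ (2 * (B * y i))).
    by rewrite ler_pM2l.
  have -> : 2 * (B * y i) = A * (K * y i).
    by rewrite /K mulrA mulrA (mulrC A) divfK ?gt_eqF.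
  by rewrite ler_pM2l.
have iter i : (i1 <= i)%N -> K * y i <= x i.
  elim: i => [|i IH]; first by rewrite leqn0 => /eqP i10; rewrite -i10.
  rewrite leq_eqVlt => /orP[/eqP <- //|]; rewrite ltnS => ii.
  apply: le_trans (step i (leq_trans Ni1 ii) (IH ii)).
  rewrite expr2 ler_pM2r //; have [gy2 _] := gy.
  apply: le_trans (gy2 i.+1); apply: le_trans (geom_ge_nat _).
  by apply: HN => /=; apply: leq_trans Ni1 _; apply: leq_trans ii _; rewrite -addn2 leq_addr.
(* Two steps later the quotient of logarithms is at most [B * y i.+1 / (A * y i.+1 ^+ 2)], and
   [y i.+1 >= i.+2]; this explains the shift by 2. *)
apply: (@cvg0_inv_bound _ (2 * (B / A))); exists i1.+2 => //= -[//|[//|i]] /= ii.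
have {}ii : (i1 <= i)%N by move: ii; rewrite !ltnS.
have x1 := growth_ln_gt0 i.+1 gx; have y1 := growth_ln_gt0 i.+1 gy.
apply/andP; split; first by rewrite divr_ge0 // ltW.
have /andP[_ yB] := yAB i.+1; have /andP[xA _] := xAB i.+1.
have yx := step i (leq_trans Ni1 ii) (iter i ii).
have [gy2 _] := gy; have yi := le_trans (geom_ge_nat i.+1) (gy2 i.+1).
have i20 : 0 < i.+2%:R :> R by rewrite ltr0n.
rewrite ler_pdivrMr //; apply: le_trans yB _.
apply: (@le_trans _ _ (2 * (B / A) / i.+2%:R * (A * x i.+1))); last first.
  by rewrite ler_pM2l // divr_gt0 // mulr_gt0 // divr_gt0.
have -> : 2 * (B / A) / i.+2%:R * (A * x i.+1) = B * (2 / i.+2%:R * x i.+1).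
  by field; rewrite gt_eqF //= gt_eqF.
rewrite ler_pM2l //; apply: (@le_trans _ _ (2 / i.+2%:R * (y i.+1 ^+ 2))); last first.
  by rewrite ler_pM2l // divr_gt0.
rewrite expr2 mulrA ler_peMl ?(ltW (y0 _)) // mulrAC ler_pdivlMr // mul1r.
by apply: le_trans yi _; rewrite ler_peMl ?(ltW (y0 _)) // ler1n.
Qed.

(** If neither sequence dominates, each is eventually below a constant multiple of the other. Their
    logarithms then differ by a bounded amount, while [ln (y i)] grows at least linearly. *)
Lemma growth_trichotomy x y : growth x -> growth y ->
  [\/ (fun i => ln (x i) / ln (y i)) @ \oo --> (0 : R),
      (fun i => ln (x i) / ln (y i)) @ \oo --> (1 : R) |
      (fun i => ln (y i) / ln (x i)) @ \oo --> (0 : R)].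
Proof.
move=> gx gy.
have x0 i := growth_gt0 i gx; have y0 i := growth_gt0 i gy.
have [K K0 HK] := growth_dominate gx gy.
have [K' K'0 HK'] := growth_dominate gy gx.
have [/HK ?|] := pselect (forall i0, exists2 i, (i0 <= i)%N & K * y i <= x i).
  exact: Or33.
move=> /existsNP[N1 /forall2NP xK].
have [/HK' ?|] := pselect (forall i0, exists2 i, (i0 <= i)%N & K' * x i <= y i).
  exact: Or31.
move=> /existsNP[N2 /forall2NP yK]; apply: Or32.
pose M := Num.max (ln K) (ln K').
have close i : (maxn N1 N2 <= i)%N -> `|ln (x i) - ln (y i)| <= M.
  rewrite geq_max => /andP[i1 i2]; rewrite ler_norml /M.
  have {xK} xK : x i < K * y i.
    by case: (xK i) => // /negP; rewrite -ltNge.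
  have {yK} yK : y i < K' * x i.
    by case: (yK i) => // /negP; rewrite -ltNge.
  move: xK yK; rewrite -ltr_ln ?posrE ?mulr_gt0 // lnM ?posrE // => h1.
  rewrite -ltr_ln ?posrE ?mulr_gt0 // lnM ?posrE // => h2.
  have m1 : ln K <= Num.max (ln K) (ln K') by rewrite le_max lexx.
  have m2 : ln K' <= Num.max (ln K) (ln K') by rewrite le_max lexx orbT.
  by apply/andP; split; lra.
apply/subr_cvg0/norm_cvg0P; apply: (@cvg0_inv_bound _ (M / ln 2)).
exists (maxn N1 N2).+1 => //= -[//|i] ii.
have l20 : 0 < ln 2 :> R by rewrite ln_gt0 // ltr1n.
have yl := growth_ln_gt0 i gy.
have M0 : 0 <= M by apply: le_trans (close i.+1 (ltnW ii)).
rewrite normr_ge0 /=.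
have -> : ln (x i.+1) / ln (y i.+1) - 1 = (ln (x i.+1) - ln (y i.+1)) / ln (y i.+1).
  by rewrite mulrBl divff // gt_eqF.
rewrite normrM normfV (gtr0_norm yl) ler_pdivrMr //.
apply: le_trans (close _ (ltnW ii)) _.
have {1}-> : M = M / ln 2 / i.+1%:R * (i.+1%:R * ln 2).
  by rewrite mulrA divfK ?pnatr_eq0 // divfK // gt_eqF.
rewrite ler_wpM2l //; last exact: growth_ln.
by rewrite !mulr_ge0 // invr_ge0 // ltW.
Qed.

Lemma cvg_sum_fin (I : Type) (s : seq I) (P : pred I) (u : I -> nat -> R) (l : I -> R) :
  (forall i, P i -> u i @ \oo --> l i) ->
  (fun n => \sum_(i <- s | P i) u i n) @ \oo --> \sum_(i <- s | P i) l i.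
Proof.
move=> ul; elim: s => [|i s IH].
  by rewrite big_nil; under eq_fun do rewrite big_nil; exact: cvg_cst.
rewrite big_cons; under eq_fun do rewrite big_cons.
by have [Pi|_] := ifP; [apply: cvgD => //; exact: ul|].
Qed.

(** If some [ln (x k i)] dominates [ln (x j i)], the share tends to 0. Otherwise each quotient
    [ln (x k i) / ln (x j i)] tends to 0 or 1, and the share is the inverse of their sum, whose
    limit is at least 1 by the term [k = j]. *)
Lemma growth_share_cvg (I : finType) (x : I -> nat -> R) (j : I) :
  (forall k, growth (x k)) ->
  exists l : R, (fun i => ln (x j i) / \sum_k ln (x k i)) @ \oo --> l.
Proof.
move=> gx; pose S i := \sum_k ln (x k i).
have ln_ge k i : 0 <= ln (x k i).
  apply: le_trans (growth_ln i (gx k)).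
  by rewrite mulr_ge0 // ln_ge0 // ler1n.
have leS k i : ln (x k i) <= S i.
  by rewrite /S (bigD1 k) //= lerDl sumr_ge0.
have [[k xjk]|/forallNP nxjk] :=
    pselect (exists k, (fun i => ln (x j i) / ln (x k i)) @ \oo --> (0 : R)).
  exists 0; apply: (@squeeze_cvgr _ _ _ _ (fun=> 0) (fun i => ln (x j i) / ln (x k i))).
  - exists 1%N => //= -[//|i] _; rewrite divr_ge0 ?sumr_ge0 //=.
    rewrite ler_wpM2l // lef_pV2 ?posrE ?growth_ln_gt0 //.
    by rewrite (lt_le_trans _ (leS k _)) ?growth_ln_gt0.
  - exact: cvg_cst.
  - exact: xjk.
have /choice[l lP] k : exists l : R, 0 <= l /\ (fun i => ln (x k i) / ln (x j i)) @ \oo --> l.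
  have [h|h|h] := growth_trichotomy (gx k) (gx j); first by exists 0.
    by exists 1.
  by case: (nxjk k).
have lj : l j = 1.
  apply: cvg_unique (lP j).2 _ => //; apply: cvg_near_cst.
  by exists 1%N => //= -[//|i] _; rewrite divff // gt_eqF // growth_ln_gt0.
exists (\sum_k l k)^-1.
have : (fun i => \sum_k (ln (x k i) / ln (x j i))) @ \oo --> \sum_k l k.
  by apply: cvg_sum_fin => k _; have [] := lP k.
move=> /cvgV; under [X in (X @ _)%classic --> _]eq_fun do rewrite /= -mulr_suml invf_div.
apply; rewrite gt_eqF // (lt_le_trans (ltr01)) // -lj (bigD1 j) //= lerDl.
by rewrite sumr_ge0 // => k _; have [] := lP k.
Qed.

(** At [i.+1] the quotient is at most [B * y i / (A * x i)], that is, [B / (A * q i)]. *)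
Lemma negligible_ratio (x y : nat -> nat) (q : nat -> nat) (A B : R) :
  0 < A -> 0 < B -> (forall i, (0 < x i)%N) -> (forall i, x i = (y i * q i)%N) ->
  (forall i, A * (x i)%:R <= ln (x i.+1)%:R) ->
  (forall i, ln (y i.+1)%:R <= B * (y i)%:R) ->
  (forall n, exists i0, forall i, (i0 <= i)%N -> (n <= q i)%N) ->
  (fun i => ln (y i)%:R / ln (x i)%:R : R) @ \oo --> (0 : R).
Proof.
move=> A0 B0 x0 xE xA yB qoo; apply/cvgrPdist_le => e e0.
have [N _ HN] := nbhs_infty_ger (B / (A * e)).
have [i0 Hi0] := qoo N.+1; exists i0.+1 => //= -[//|i] ii.
have := Hi0 i ii; have := x0 i; rewrite xE muln_gt0 => /andP[yi qi] Nq.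
have y1 : 0 <= ln (y i.+1)%:R :> R.
  rewrite ln_ge0 // ler1n; have := x0 i.+1; rewrite xE muln_gt0.
  by case/andP.
have xi1 : 0 < A * (x i)%:R by rewrite mulr_gt0 // ltr0n.
have x1 := lt_le_trans xi1 (xA i).
rewrite sub0r normrN ger0_norm ?divr_ge0 ?(ltW x1) // ler_pdivrMr //.
apply: le_trans (yB i) _; apply: le_trans (_ : e * (A * (x i)%:R) <= _); last first.
  by rewrite ler_pM2l.
have -> : e * (A * (x i)%:R) = (e * (A * (q i)%:R)) * (y i)%:R.
  by rewrite xE natrM; ring.
rewrite ler_pM2r ?ltr0n //.
have := HN (q i) (ltnW Nq); rewrite /= ler_pdivrMr ?mulr_gt0 //.
by rewrite [(q i)%:R * _]mulrC -mulrA mulrCA.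
Qed.

End GrowthRates.

(** * Positive rank gradient *)

Section RankGradient.
Local Open Scope ring_scope.
Variables (R : realType) (p : nat) (G : topGroupType).
Implicit Types (A K M V W Z : set G).

Lemma rank_gradient_gt0 : compact [set: G] -> (0 < rank_gradient R G)%E ->
  exists2 c : R, 0 < c & forall K s, open K -> subgroup K ->
    top_gen [set` s] = K -> c * (gindex [set: G] K)%:R <= (size s)%:R - 1.
Proof.
move=> cG rg; have [c c0 cle] : exists2 c : R, 0 < c & (c%:E <= rank_gradient R G)%E.
  (* An infinite rank gradient is bounded below by [c = 1]. *)
  case: (rank_gradient R G) rg => [r||] //= r0; last by exists 1; rewrite ?leey.
  by exists r; rewrite -?lte_fin.
exists c => // K s oK sK sE.
have n0 : 0 < (gindex [set: G] K)%:R :> R.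
  rewrite ltr0n; apply: gindex_gt0 => //; first by exists 1%g.
  exact: compact_open_fin_index.
have : (c%:E <= (min_gens R K - 1) / (gindex [set: G] K)%:R%:E)%E.
  by apply: le_trans cle _; apply: ereal_inf_lbound; exists K.
rewrite inver gt_eqF // lee_pdivlMr // => le; rewrite -lee_fin EFinM EFinB.
apply: le_trans le _; apply: leeB => //; apply: ereal_inf_lbound.
by exists s.
Qed.

Hypotheses (pp : prime p) (pG : pro_p p G) (fG : finitely_generated G).
Hypothesis rgG : (0 < rank_gradient R G)%E.

Local Notation ind A := (gindex [set: G] A).
Local Notation Phi := (@frattini G p).

(** [k] is the size of the generating set found by [frattini_generators], to which the lower bound
    of the rank gradient applies. *)
Lemma rank_gradient_frat : exists2 c : R, 0 < c &
  forall W, open W -> subgroup W ->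
  exists2 k, c * (ind W)%:R <= k%:R - 1 & (2 ^ k <= gindex W (frat p W))%N.
Proof.
have [[cG _ _] _] := pG; have [c c0 cP] := rank_gradient_gt0 cG rgG.
exists c => // W oW sW; have [s0 s0G] := fG.
have [fF _ _] := open_frat pp pG s0G sW oW.
have [s [sE s2]] := frattini_generators pp pG (open_subgroup_closed sW oW) sW fF.
by exists (size s) => //; exact: cP.
Qed.

Lemma ind_gt0 K : open K -> subgroup K -> (0 < ind K)%N.
Proof.
move=> oK sK; apply: gindex_gt0 => //; first by exists 1%g.
by apply: (open_fin_index pG).
Qed.

Lemma frattini_growth : growth (fun i => (ind (Phi i))%:R : R).
Proof.
have [c c0 cP] := rank_gradient_frat; have [s0 s0G] := fG.
have oF i := (frattini_open_normal pp pG s0G i).1.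
have nF i := (frattini_open_normal pp pG s0G i).2.
have x0 i : (0 < ind (Phi i))%N by apply: ind_gt0 => //; case: (nF i).
have xS i : exists2 k, c * (ind (Phi i))%:R <= k%:R - 1 &
    (ind (Phi i) * 2 ^ k <= ind (Phi i.+1))%N.
  have [k ck k2] := cP _ (oF i) (nF i).1; exists k => //.
  by have [_ ->] := ind_frattiniS pp pG s0G i; rewrite leq_mul2l k2 orbT.
have l2 : 0 < ln 2 :> R by rewrite ln_gt0 // ltr1n.
have lp : 0 <= ln p%:R :> R by rewrite ln_ge0 // ler1n prime_gt0.
split.
  elim=> [|i IH]; first by rewrite expr0 ler1n.
  have [k ck k2] := xS i; apply: (@le_trans _ _ (ind (Phi i) * 2 ^ k)%N%:R); last first.
    by rewrite ler_nat.
  rewrite exprSr natrM; apply: ler_pM => //; rewrite ?exprn_ge0 // ler_nat.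
  (* [k - 1] is bounded below by a positive number, so [k] is not 0 and the index at least
     doubles. *)
  case: k {k2} ck => [|k] ck; last by rewrite expnS leq_pmulr // expn_gt0.
  have : 0 < c * (ind (Phi i))%:R by rewrite mulr_gt0 // ltr0n.
  lra.
(* With [x] the index of [Phi i], the lower constant comes from [2 ^ k] with [k >= c x], the upper
   one from [ln (x p ^ (d x)) <= x + d x ln p], where [d] is the size of [s0]. *)
exists (c * ln 2), (1 + (size s0)%:R * ln p%:R); split.
- exact: mulr_gt0.
- by rewrite ltr_wpDr // mulr_ge0.
move=> i; apply/andP; split.
  have [k ck k2] := xS i.
  apply: (@le_trans _ _ (ln (2 ^ k)%N%:R)); last first.
    rewrite ler_ln ?posrE ?ltr0n ?expn_gt0 // ler_nat; apply: leq_trans k2.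
    by rewrite leq_pmull.
  rewrite natrX lnXn // -[leRHS]mulr_natl mulrAC ler_pM2r //; lra.
apply: (@le_trans _ _ (ln (ind (Phi i) * p ^ (size s0 * ind (Phi i)))%N%:R)).
  rewrite ler_ln ?posrE ?ltr0n ?muln_gt0 ?x0 ?expn_gt0 ?prime_gt0 // ler_nat.
  exact: (ind_frattini_ub pp pG s0G i).
rewrite natrM natrX lnM ?posrE ?exprn_gt0 ?ltr0n ?x0 ?prime_gt0 // lnXn ?ltr0n ?prime_gt0 //.
rewrite -[X in _ + X <= _]mulr_natl natrM mulrDl mul1r lerD //.
  by apply: ln_le_id; rewrite ltr0n.
by rewrite mulrAC.
Qed.

(** Let [w = |G : V Z|] and [q = |V Z : V|]. The rank gradient makes [k] larger than [c q w],
    whereas [center_frat_index] bounds [k] by a constant times [w]; an infinite [Z] allows [q] to be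
    arbitrarily large. *)
Lemma no_infinite_center Z : subgroup Z -> (forall z x : G, Z z -> (z * x)%g = (x * z)%g) ->
  finite_set Z.
Proof.
move=> sZ zZ; apply: contrapT => iZ.
have [c c0 cP] := rank_gradient_frat; have [s0 s0G] := fG.
(* The threshold is where [c q w < k <= p d w] becomes impossible, with [d] the size of [s0]. *)
have [N _ HN] := nbhs_infty_ger ((p * size s0)%:R / c + 1 : R).
have [V [t [oV nV [tZ tV]]]] := infinite_separated N pG.1 iZ.
have nZ : normal_subgroup Z by split=> // z y Zz; rewrite conjgE (zZ z y Zz) mulKg.
have [k ck k2] := cP V oV nV.1.
set W := setmul V Z in k2.
have VW : V `<=` W by exact: setmul_subl.
have nW : normal_subgroup W by exact: setmul_normal2.
have oW : open W by exact: open_subgroup_sup oV nV.1 nW.1 VW.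
(* [p ^ e] is at most [2 ^ (p e)], which brings both estimates to base 2. *)
have kle : (k <= p * (size s0 * ind W))%N.
  rewrite -(@leq_exp2l 2) //; apply: leq_trans k2 _.
  apply: leq_trans (center_frat_index pp pG s0G sZ zZ oV nV) _.
  rewrite -/W [leqRHS]expnM; case: (size s0 * _)%N => // e.
  by rewrite leq_exp2r // ltnW // ltn_expl.
have [_ E] := gindex_mul (@subgroupT G) nW.1 nV.1 VW (@subsetT _ _)
  (open_fin_index pG nW.1 oW) (fin_index_le (@subsetT _ W) (open_fin_index pG nV.1 oV)).
have Nq : (N <= gindex W V)%N.
  rewrite -[X in (X <= _)%N]card_ord; apply: (card_le_gindex (t := t) nV.1).
    exact: fin_index_le (@subsetT _ W) (open_fin_index pG nV.1 oV).
  split=> // i; apply: setmul_subr; [by case: nV | exact: tZ].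
have := HN (gindex W V) Nq; rewrite /= -lerBrDr ler_pdivrMr // => {}HN.
move: ck; rewrite E natrM.
have w0 : 0 < (ind W)%:R :> R by rewrite ltr0n; apply: ind_gt0 => //; case: nW.
move: kle; rewrite -(ler_nat R) mulnA natrM => kle ck.
have : (p * size s0)%:R * (ind W)%:R <= ((gindex W V)%:R - 1) * c * (ind W)%:R.
  by rewrite ler_pM2r.
have : 0 < c * (ind W)%:R by rewrite mulr_gt0.
set q := (gindex W V)%:R in HN ck *; set w := (ind W)%:R in w0 kle ck *.
set P := (p * size s0)%:R in kle *.
move=> h1 h2.
have e1 : c * (w * q) = (q - 1) * c * w + c * w by ring.
lra.
Qed.

Lemma infinite_normal_negligible M : normal_subgroup M -> infinite_set M ->
  (fun i => ln (ind (setmul M (Phi i)))%:R / ln (ind (Phi i))%:R : R) @ \oo --> (0 : R).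
Proof.
move=> nM iM; have [s0 s0G] := fG.
have [_ [A [B [A0 B0 gAB]]]] := frattini_growth.
have y0 i : (0 < ind (setmul M (Phi i)))%N.
  have [oW nW] := normal_frattini_open pp pG s0G i nM.
  by apply: ind_gt0 => //; case: nW.
have lp : 0 <= ln p%:R :> R by rewrite ln_ge0 // ler1n prime_gt0.
apply: (@negligible_ratio _ _ _ (fun i => gindex (setmul M (Phi i)) (Phi i)) A
  (1 + (size s0)%:R * ln p%:R)) => //.
- by rewrite ltr_wpDr // mulr_ge0.
- move=> i; have [oF nF] := frattini_open_normal pp pG s0G i.
  by apply: ind_gt0 => //; case: nF.
- by move=> i; have [] := ind_normal_frattini pp pG s0G i nM.
- by move=> i; have /andP[] := gAB i.
- move=> i; set y := ind (setmul M (Phi i)) in y0 *.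
  apply: (@le_trans _ _ (ln (y * p ^ (size s0 * y))%N%:R)).
    rewrite ler_ln ?posrE ?ltr0n ?muln_gt0 ?y0 ?expn_gt0 ?prime_gt0 // ler_nat.
    exact: (ind_normal_frattini_ub pp pG s0G i nM).
  rewrite natrM natrX lnM ?posrE ?exprn_gt0 ?ltr0n ?y0 ?prime_gt0 // lnXn ?ltr0n ?prime_gt0 //.
  rewrite -[X in _ + X <= _]mulr_natl natrM mulrDl mul1r lerD //.
    by apply: ln_le_id; rewrite ltr0n y0.
  by rewrite mulrAC.
- by move=> n; exact: (infinite_gindex pp pG s0G n iM).
Qed.

End RankGradient.

(** * Direct products of topological groups *)

Section DirectProduct.
Variables (I : finType) (H : I -> topGroupType).
Local Notation G := (prod_topology H).
Implicit Types (A B : forall i, set (H i)) (x y : G).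

Definition box A : set G := [set x | forall i, A i (x i)].

Definition embed j (h : H j) : G := dfwith (fun k => 1 : H k) j h.

Lemma embedE j (h : H j) : embed h j = h.
Proof. exact: dfwithin. Qed.

Lemma embed_out j k (h : H j) : j != k -> embed h k = 1.
Proof. by move=> jk; apply: dfwithout. Qed.

Lemma prod_ext x y : (forall i, x i = y i) -> x = y.
Proof. by move=> xy; apply: functional_extensionality_dep. Qed.

Lemma prod_mulE x y i : (x * y) i = x i * y i. Proof. by []. Qed.
Lemma prod_invE x i : x^-1 i = (x i)^-1. Proof. by []. Qed.
Lemma prod_commE x y i : [~ x, y] i = [~ x i, y i]. Proof. by []. Qed.
Lemma prod_expE x n i : (x ^+ n) i = x i ^+ n.
Proof. by elim: n => // n IH; rewrite !expgS prod_mulE IH. Qed.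

Lemma embedM j (h k : H j) : embed (h * k) = embed h * embed k.
Proof.
apply: prod_ext => i; rewrite prod_mulE; have [ji|ji] := eqVneq j i.
  by case: _ / ji; rewrite !embedE.
by rewrite !embed_out // mulg1.
Qed.

Lemma embed1 j : embed (1 : H j) = 1.
Proof.
by apply: (mulgI (embed (1 : H j))); rewrite -[LHS]embedM !mulg1.
Qed.

Lemma embedV j (h : H j) : embed h^-1 = (embed h)^-1.
Proof. by apply: (mulgI (embed h)); rewrite -embedM !mulgV embed1. Qed.

Lemma embedX j (h : H j) n : embed (h ^+ n) = embed h ^+ n.
Proof. by elim: n => [|n IH]; rewrite ?embed1 // !expgS embedM IH. Qed.

Lemma embedR j (h k : H j) : embed [~ h, k] = [~ embed h, embed k].
Proof. by rewrite /commg /conjg !embedM !embedV. Qed.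

Lemma embed_continuous j : continuous (@embed j).
Proof.
apply: dprod_continuousP => i; have [ji|ji] := eqVneq j i.
  case: _ / ji; rewrite (_ : (fun h => _) = id); last first.
    by apply/funext => h; rewrite embedE.
  by move=> h; exact: cvg_id.
rewrite (_ : (fun h => _) = (fun=> 1)); last first.
  by apply/funext => h; rewrite embed_out.
by move=> h; exact: cvg_cst.
Qed.

Lemma box_embed A j (h : H j) : (forall i, subgroup (A i)) -> A j h -> box A (embed h).
Proof.
move=> sA Ah i; have [ji|ji] := eqVneq j i; first by case: _ / ji; rewrite embedE.
by rewrite embed_out //; exact: subgroup1.
Qed.

Lemma box_subgroup A : (forall i, subgroup (A i)) -> subgroup (box A).
Proof.
move=> sA; split=> [i|x y Ax Ay i|x Ax i].
- exact: subgroup1.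
- exact: subgroupM.
- exact: subgroupV.
Qed.

Lemma box_closed A : (forall i, closed (A i)) -> closed (box A).
Proof.
move=> cA; rewrite (_ : box A = \bigcap_(i in [set: I]) [set x : G | A i (x i)]).
  apply: closed_bigI => i _; apply: (closed_continuous _ (cA i)).
  exact: dprod_proj_continuous.
by apply/seteqP; split=> x Ax i => [_|]; exact: Ax.
Qed.

(** An element of the box is the finite product of its embedded coordinates, taken along an
    enumeration of [I]. *)
Lemma box_min A (B : set G) : subgroup B ->
  (forall j (h : H j), A j h -> B (embed h)) -> box A `<=` B.
Proof.
move=> sB AB x Ax.
pose xs (s : seq I) : G := fun i => if i \in s then x i else 1.
have -> : x = xs (enum I) by apply: prod_ext => i; rewrite /xs mem_enum.
elim: (enum I) (enum_uniq I) => [_|j s IH /= /andP[js us]].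
  by rewrite (_ : xs _ = 1); [exact: subgroup1 | exact: prod_ext].
rewrite (_ : xs _ = embed (x j) * xs s).
  by apply: subgroupM (IH us) => //; exact: AB.
apply: prod_ext => i; rewrite prod_mulE /xs in_cons.
have [ij|ij] := eqVneq i j.
  by case: _ / (esym ij); rewrite embedE (negbTE js) mulg1.
by rewrite embed_out ?mul1g // eq_sym.
Qed.

Lemma embed_preim_subgroup j (B : set G) : subgroup B ->
  subgroup [set h : H j | B (embed h)].
Proof.
move=> sB; split=> [|h k Bh Bk|h Bh] /=.
- by rewrite embed1; exact: subgroup1.
- by rewrite embedM; exact: subgroupM.
- by rewrite embedV; exact: subgroupV.
Qed.

(** Generators could in general tie the coordinates together; the second hypothesis puts each
    coordinate of a generator into [S] on its own. *)
Lemma top_gen_box (S : set G) A : (forall i, A i = top_gen [set x i | x in S]) ->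
  (forall j x, S x -> S (embed (x j))) -> top_gen S = box A.
Proof.
move=> AE SE; apply/seteqP; split.
  apply: top_gen_min.
  - by apply: box_closed => i; rewrite AE; exact: top_gen_closed.
  - by apply: box_subgroup => i; rewrite AE; exact: top_gen_subgroup.
  - by move=> x Sx i; rewrite AE; apply: top_gen_sub; exists x.
apply: box_min; first exact: top_gen_subgroup.
move=> j h; rewrite AE; apply: (top_gen_min (B := [set h : H j | top_gen S (embed h)])).
- by apply: (closed_continuous _ (@top_gen_closed _ _)); exact: embed_continuous.
- by apply: embed_preim_subgroup; exact: top_gen_subgroup.
- by move=> _ [x Sx <-]; apply: top_gen_sub; exact: SE.
Qed.

Lemma setmul_box A B : setmul (box A) (box B) = box (fun i => setmul (A i) (B i)).
Proof.
apply/seteqP; split=> [_ [x Ax [y By <-]] i|x ABx].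
  by exists (x i) => //; exists (y i).
have f i : {u : H i * H i | [/\ A i u.1, B i u.2 & u.1 * u.2 = x i]}.
  by apply: cid; have [a Aa [b Bb ab]] := ABx i; exists (a, b).
exists (fun i => (projT1 (f i)).1); first by move=> i; case: (projT2 (f i)).
exists (fun i => (projT1 (f i)).2); first by move=> i; case: (projT2 (f i)).
by apply: prod_ext => i; case: (projT2 (f i)).
Qed.

Lemma gindex_box A B : (forall i, subgroup (B i)) ->
  (forall i, fin_index (A i) (B i)) ->
  fin_index (box A) (box B) /\
  gindex (box A) (box B) = (\prod_i gindex (A i) (B i))%N.
Proof.
move=> sB fAB.
have t i : {t : 'I_(gindex (A i) (B i)) -> H i |
    separated t (A i) (B i) /\ covers t (A i) (B i)}.
  by apply: cid; exact: gindex_transversal.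
pose u (f : {dffun forall i, 'I_(gindex (A i) (B i))}) : G := fun i => projT1 (t i) (f i).
have su : separated u (box A) (box B).
  split=> [f i|f g fg]; first by have [[tA _] _] := projT2 (t i); exact: tA.
  by apply/ffunP => i; have [[_ tB] _] := projT2 (t i); apply: tB; exact: fg.
have cu : covers u (box A) (box B).
  move=> x Ax.
  have k i : {k | B i ((projT1 (t i) k)^-1 * x i)}.
    by apply: cid; have [_ tc] := projT2 (t i); exact: tc.
  exists [ffun i => projT1 (k i)] => i; rewrite prod_mulE prod_invE /u ffunE.
  exact: (projT2 (k i)).
have sBb := box_subgroup sB; have [fb _] := gindex_le_card sBb cu; split=> //.
rewrite (gindex_card sBb su cu) card_dep_ffun foldrE big_map big_enum /=.
by under eq_bigr do rewrite card_ord.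
Qed.

(** Restricting a commutator or a power to one coordinate gives a commutator or a power again, as
    [top_gen_box] requires. *)
Lemma frat_box p A : (forall i, subgroup (A i)) ->
  frat p (box A) = box (fun i => frat p (A i)).
Proof.
move=> sA; rewrite /frat.
have -> : comm_subgroup (box A) (box A) = box (fun i => comm_subgroup (A i) (A i)).
  apply: top_gen_box => [i|j _ [x Ax [y Ay <-]]].
    congr top_gen; apply/seteqP; split.
      move=> _ [h Ah [k Ak <-]]; exists [~ embed h : G, embed k].
        by exists (embed h); [exact: box_embed | exists (embed k) => //; exact: box_embed].
      by rewrite prod_commE !embedE.
    by move=> _ [_ [x Ax [y Ay <-]] <-]; exists (x i) => //; exists (y i).
  exists (embed (x j)); first exact: box_embed.
  by exists (embed (y j)); [exact: box_embed | rewrite -embedR].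
have -> : pow_subgroup p (box A) = box (fun i => pow_subgroup p (A i)).
  apply: top_gen_box => [i|j _ [x Ax <-]].
    congr top_gen; apply/seteqP; split.
      move=> _ [h Ah <-]; exists (embed h ^+ p); last by rewrite prod_expE embedE.
      by exists (embed h) => //; exact: box_embed.
    by move=> _ [_ [x Ax <-] <-]; exists (x i) => //; rewrite prod_expE.
  exists (embed (x j)); first exact: box_embed.
  by rewrite -embedX prod_expE.
exact: setmul_box.
Qed.

Lemma frattini_box p n : (forall i k, subgroup (@frattini (H i) p k)) ->
  @frattini G p n = box (fun i => @frattini (H i) p n).
Proof.
move=> sF; elim: n => [|n IH]; first by apply/seteqP; split.
by rewrite [LHS](_ : _ = frat p (@frattini G p n)) // IH frat_box.
Qed.

End DirectProduct.

(** * Normal subgroups of the product *)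

Local Open Scope ring_scope.

Lemma gindex_finite_le (G : topGroupType) (A B : set G) : finite_set A ->
  subgroup B -> (gindex (setmul A B) B <= #|` fset_set A|)%N.
Proof.
move=> fA sB; have cov : covers (val : fset_set A -> G) (setmul A B) B.
  move=> _ [a Aa [b Bb <-]]; have aA : a \in fset_set A by rewrite in_fset_set // inE.
  by exists [` aA]%fset; rewrite mulKg.
by have [_] := gindex_le_card sB cov; rewrite -cardfE.
Qed.

Lemma infinite_setI_fin_index (G : topGroupType) (A K : set G) : subgroup A ->
  subgroup K -> fin_index A K -> finite_set (A `&` K) -> finite_set A.
Proof.
move=> sA sK fAK fI; have [t [[tA _] tc]] := gindex_transversal sK fAK.
apply: (@sub_finite_set _ _ (\bigcup_(i in [set: 'I_(gindex A K)])
    [set (t i * z)%g | z in A `&` K])); last first.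
  apply: bigcup_finite => [|i _]; first exact: finite_finset.
  exact: finite_image.
move=> a Aa; have [i Ki] := tc _ Aa; exists i => //; exists ((t i)^-1 * a)%g.
  by split=> //; apply: subgroupM => //; exact: subgroupV.
by rewrite mulVKg.
Qed.

Section Factors.
Variables (R : realType) (p : nat) (I : finType) (H : I -> topGroupType).
Hypotheses (pp : prime p) (pH : forall j, pro_p p (H j))
  (fH : forall j, finitely_generated (H j))
  (rgH : forall j, (0 < rank_gradient R (H j))%E).
Local Notation G := (prod_topology H : topGroupType).
Implicit Types N : set G.

Local Notation Phi j i := (@frattini (H j) p i).
Local Notation ind j A := (gindex [set: H j] A).

Definition proj N j : set (H j) := [set x j | x in N].
(** The intersection of [N] with the [j]-th factor, pulled back to [H j]. *)
Definition meet N j : set (H j) := [set h | N (embed h)].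
Arguments proj : clear implicits.
Arguments meet : clear implicits.

Let oPhi j i : open (Phi j i).
Proof. by have [s sG] := fH j; have [] := frattini_open_normal pp (pH j) sG i. Qed.

Let nPhi j i : normal_subgroup (Phi j i).
Proof. by have [s sG] := fH j; have [] := frattini_open_normal pp (pH j) sG i. Qed.

Let sPhi j i : subgroup (Phi j i). Proof. by case: (nPhi j i). Qed.

Let fPhi j i (A : set (H j)) : fin_index A (Phi j i).
Proof.
apply: (fin_index_le (@subsetT _ _)).
exact: (open_fin_index (pH j) (@sPhi j i) (@oPhi j i)).
Qed.

Let PhiE i : @frattini G p i = box (fun j => Phi j i).
Proof. exact: frattini_box. Qed.

Lemma proj_subgroup N j : subgroup N -> subgroup (proj N j).
Proof.
move=> sN; split.
- by exists 1%g => //; exact: subgroup1.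
- move=> _ _ [x Nx <-] [y Ny <-]; exists (x * y)%g => //; exact: subgroupM.
- move=> _ [x Nx <-]; exists x^-1%g => //; exact: subgroupV.
Qed.

Lemma meet_normal N j : normal_subgroup N -> normal_subgroup (meet N j).
Proof.
move=> nN; split; first exact: embed_preim_subgroup nN.1.
move=> h k Nh; rewrite /meet /= (_ : embed (h ^ k) = embed h ^ embed k)%g.
  exact: nN.2.
by rewrite /conjg !embedM embedV.
Qed.

(* Otherwise an open normal subgroup meeting [meet N j] trivially cuts a central
   subgroup of finite index out of the projection. *)
Lemma meet_infinite N j : normal_subgroup N -> infinite_set (proj N j) ->
  infinite_set (meet N j).
Proof.
move=> nN iP fM; apply: iP; have [cG hG _] := (pH j).1.
have [|K [oK nK KM]] := @profinite_normal (H j) (~` (meet N j `\ 1%g)) (pH j).1.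
  apply: open_nbhs_nbhs; split; last by case=> _; apply.
  apply: closed_openC; move/accessible_finite_set_closed: (hausdorff_accessible hG).
  by apply; exact: finite_setD.
have sP := proj_subgroup j nN.1.
apply: (infinite_setI_fin_index sP nK.1).
  exact: fin_index_le (@subsetT _ _) (open_fin_index (pH j) nK.1 oK).
apply: (no_infinite_center pp (pH j) (fH j) (rgH j)); first exact: subgroupI sP nK.1.
move=> _ h [[n Nn <-] Kn]; apply/commgP/eqP.
have Kc : K [~ n j, h]%g by apply: subgroupM nK.1 (subgroupV nK.1 Kn) (nK.2 _ _ Kn).
have Mc : meet N j [~ n j, h]%g.
  (* Commutation with [embed h] trivializes all coordinates but the [j]-th. *)
  rewrite /meet /= (_ : embed _ = [~ n, embed h])%g.
    by apply: subgroupM nN.1 (subgroupV nN.1 Nn) (nN.2 _ _ Nn).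
  apply: prod_ext => i; rewrite prod_commE; have [ji|ji] := eqVneq j i.
    by case: _ / ji; rewrite !embedE.
  by rewrite !embed_out // commg1.
by apply: contrapT => c1; apply: (KM _ Kc).
Qed.

Lemma gindex_normal_ge N i : normal_subgroup N ->
  (\prod_j gindex (setmul (meet N j) (Phi j i)) (Phi j i) <=
   gindex (setmul N (@frattini G p i)) (@frattini G p i))%N.
Proof.
move=> nN; rewrite PhiE.
have [_ <-] := gindex_box (sPhi^~ i) (fun j => fPhi i (setmul (meet N j) (Phi j i))).
apply: gindex_le; first exact: box_subgroup (sPhi^~ i).
  rewrite -setmul_box; apply: setmulS => //; exact: box_min nN.1 _.
by apply: fin_index_le (gindex_box (sPhi^~ i) (fun j => fPhi i [set: H j])).1.
Qed.

Lemma gindex_normal_le N i :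
  (gindex (setmul N (@frattini G p i)) (@frattini G p i) <=
   \prod_j gindex (setmul (proj N j) (Phi j i)) (Phi j i))%N.
Proof.
rewrite PhiE.
have [fb <-] := gindex_box (sPhi^~ i) (fun j => fPhi i (setmul (proj N j) (Phi j i))).
apply: gindex_le fb; first exact: box_subgroup (sPhi^~ i).
rewrite -setmul_box; apply: setmulS => // x Nx j; by exists x.
Qed.

Lemma ind_frattini_prod i :
  gindex [set: G] (@frattini G p i) = (\prod_j ind j (Phi j i))%N.
Proof.
rewrite PhiE; have [_ <-] := gindex_box (sPhi^~ i) (fun j => fPhi i ([set: H j])).
by congr gindex; apply/seteqP; split.
Qed.


Let gPhi j : growth (fun i => (ind j (Phi j i))%:R : R).
Proof. exact: frattini_growth. Qed.

Let x_gt0 j i : (0 < ind j (Phi j i))%N.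
Proof. exact: (ind_gt0 (pH j) (@oPhi j i) (sPhi j i)). Qed.

Let ind_ge1 j i (A : set (H j)) : subgroup A -> (0 < gindex (setmul A (Phi j i)) (Phi j i))%N.
Proof.
move=> sA; apply: gindex_gt0 => //.
by exists 1%g; exact: (setmul_subl (sPhi j i) (subgroup1 sA)).
Qed.

Lemma ln_prod (f : I -> nat) : (forall j, (0 < f j)%N) ->
  ln (\prod_j f j)%N%:R = \sum_j ln (f j)%:R :> R.
Proof.
move=> f0; have [] // : (0 < \prod_j f j)%N /\
    ln (\prod_j f j)%N%:R = \sum_j ln (f j)%:R :> R.
elim/big_rec2: _ => [|j s m _ [m0 IH]]; first by rewrite ln1.
by rewrite muln_gt0 f0 m0 natrM lnM ?posrE ?ltr0n // IH.
Qed.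

(* The upper bound counts [N] in the product of its projections, the lower
   bound in the product of its intersections with the factors. *)
Lemma hdim_normal N (L : I -> R) : normal_subgroup N ->
  (forall j, (fun i => ln (ind j (Phi j i))%:R / \sum_k ln (ind k (Phi k i))%:R)
     @ \oo --> L j) ->
  hdim R p (@frattini G p) N = \sum_(j | `[< infinite_set (proj N j) >]) L j.
Proof.
move=> nN LP.
pose S i : R := \sum_k ln (ind k (Phi k i))%:R.
pose g i := gindex (setmul N (@frattini G p i)) (@frattini G p i).
pose P j := `[< infinite_set (proj N j) >].
pose y j i := ind j (setmul (meet N j) (Phi j i)).
have p2 : ln p%:R != 0 :> R by rewrite gt_eqF // ln_gt0 // ltr1n prime_gt1.
rewrite /hdim (_ : (fun i => _) = (fun i => ln (g i)%:R / S i)); last first.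
  apply/funext => i; rewrite /logb ind_frattini_prod ln_prod => [|j]; last first.
    exact: x_gt0.
  by rewrite invf_div mulrA divfK.
have lnx0 j i : 0 <= ln (ind j (Phi j i))%:R :> R.
  by rewrite ln_ge0 // ler1n; exact: x_gt0.
have leS j i : ln (ind j (Phi j i))%:R <= S i.
  by rewrite /S (bigD1 j) //= lerDl sumr_ge0.
have S0 i : 0 <= S i by exact: sumr_ge0.
have gm0 j i : (0 < gindex (setmul (meet N j) (Phi j i)) (Phi j i))%N.
  by apply: ind_ge1; case: (meet_normal j nN).
have gp0 j i : (0 < gindex (setmul (proj N j) (Phi j i)) (Phi j i))%N.
  by apply: ind_ge1; apply: proj_subgroup; case: nN.
have g0 i : (0 < g i)%N.
  by apply: leq_trans (gindex_normal_ge i nN); rewrite prodn_gt0.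
(* Factors outside [P] are dropped; for the others the index of the intersection is
   [ind j (Phi j i)] divided by [y j i]. *)
have lower i : \sum_(j | P j) (ln (ind j (Phi j i))%:R - ln (y j i)%:R) <= ln (g i)%:R :> R.
  apply: (@le_trans _ _ (ln (\prod_j gindex (setmul (meet N j) (Phi j i)) (Phi j i))%N%:R)).
    rewrite ln_prod // [leRHS](bigID P) /= -[leLHS]addr0 lerD //; last first.
      by apply: sumr_ge0 => j _; rewrite ln_ge0 // ler1n.
    apply: ler_sum => j _; have [s sG] := fH j.
    have [_ E] := ind_normal_frattini pp (pH j) sG i (meet_normal j nN).
    have := x_gt0 j i; rewrite E muln_gt0 => /andP[y0 _].
    by rewrite natrM lnM ?posrE ?ltr0n // addrAC subrr add0r.
  by rewrite ler_ln ?posrE ?ltr0n ?prodn_gt0 // ler_nat; exact: gindex_normal_ge.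
(* Meaningful only for finite projections, whose contribution is thus bounded independently of
   [i]. *)
pose C j := #|` fset_set (proj N j)|.
have gC j i : ~~ P j -> (gindex (setmul (proj N j) (Phi j i)) (Phi j i) <= C j)%N.
  by move=> /asboolPn/contrapT fPj; exact: gindex_finite_le.
have upper i : ln (g i)%:R <= \sum_(j | P j) ln (ind j (Phi j i))%:R +
    \sum_(j | ~~ P j) ln (C j)%:R :> R.
  apply: (@le_trans _ _ (ln (\prod_j gindex (setmul (proj N j) (Phi j i)) (Phi j i))%N%:R)).
    by rewrite ler_ln ?posrE ?ltr0n ?prodn_gt0 // ler_nat; exact: gindex_normal_le.
  rewrite ln_prod // [leLHS](bigID P) /= lerD //; apply: ler_sum => j Pj.
    by rewrite ler_ln ?posrE ?ltr0n // ler_nat; apply: gindex_le (fPhi i _).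
  by rewrite ler_ln ?posrE ?ltr0n ?(leq_trans _ (gC j i Pj)) // ler_nat gC.
have [] // := @cvg_limn_inf_sup R (fun i => ln (g i)%:R / S i) (\sum_(j | P j) L j).
apply: (@squeeze_cvgr _ _ _ _
  (fun i => \sum_(j | P j) (ln (ind j (Phi j i))%:R / S i -
     (ln (y j i)%:R / ln (ind j (Phi j i))%:R) * (ln (ind j (Phi j i))%:R / S i)))
  (fun i => \sum_(j | P j) (ln (ind j (Phi j i))%:R / S i) +
     \sum_(j | ~~ P j) (ln (C j)%:R / S i))).
(* The position 0 is left out: there all indices are 1 and [S] vanishes. *)
- exists 1%N => //= -[//|i] _.
  apply/andP; split; last first.
    by rewrite -!mulr_suml -mulrDl ler_wpM2r // invr_ge0.
  apply: (@le_trans _ _ ((\sum_(j | P j)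
      (ln (ind j (Phi j i.+1))%:R - ln (y j i.+1)%:R)) / S i.+1)).
    rewrite mulr_suml; apply: ler_sum => j _.
    by rewrite mulrA divfK ?mulrBl // gt_eqF // (growth_ln_gt0 i (gPhi j)).
  by rewrite ler_wpM2r // invr_ge0.
- apply: cvg_sum_fin => j /asboolP Pj.
  rewrite -[X in _ --> X]subr0 -[X in _ --> _ - X](mul0r (L j)).
  apply: cvgB; first exact: LP.
  apply: cvgM; last exact: LP.
  apply: infinite_normal_negligible => //; first exact: meet_normal.
  exact: meet_infinite.
- rewrite -[X in _ --> X]addr0; apply: cvgD.
    by apply: cvg_sum_fin => j _; exact: LP.
  have z : \sum_(j | ~~ P j) (0 : R) = 0 by rewrite big1_eq.
  rewrite -[X in _ --> X]z; apply: cvg_sum_fin => j nPj.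
  apply: (@cvg0_inv_bound _ _ (ln (C j)%:R / ln 2)); exists 1%N => //= -[//|i] _.
  have C1 : 0 <= ln (C j)%:R :> R.
    by rewrite ln_ge0 // ler1n (leq_trans (gp0 j 0%N)) // gC.
  rewrite divr_ge0 //= -mulrA -invfM ler_wpM2l // lef_pV2 ?posrE.
  + by apply: le_trans (leS j _); rewrite mulrC; exact: growth_ln (gPhi j).
  + exact: lt_le_trans (growth_ln_gt0 i (gPhi j)) (leS j _).
  + by rewrite mulr_gt0 // ln_gt0 // ltr1n.
Qed.

(** * Subproducts of the factors *)

Lemma infinite_factor j : infinite_set [set: H j].
Proof.
(* A group of order [n] has no subgroup of index [2 ^ n] or more, yet [Phi j n] would be one. *)
move=> fHj; set n := #|` fset_set [set: H j]|.
have lt2 := ltn_expl n (isT : (1 < 2)%N).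
have := (gPhi j).1 n; rewrite -natrX ler_nat leqNgt => /negP; apply.
apply: leq_ltn_trans lt2; apply: leq_trans _ (gindex_finite_le fHj (sPhi j n)).
by apply: gindex_le (fPhi n _) => //; exact: setmul_subl.
Qed.

(** The closed normal subgroup that will realize the sum over [J]. *)
Definition subproduct (J : {set I}) : set G :=
  box (fun j => if j \in J then [set: H j] else [set 1%g]).

Lemma subproduct_normal J : normal_subgroup (subproduct J).
Proof.
split.
  apply: box_subgroup => j; case: ifP => _; first exact: subgroupT.
  by split=> [|x y -> ->|x ->] //=; rewrite ?mulg1 ?invg1.
move=> x y Nx j; have := Nx j; case: ifP => // _ /= xj.
by rewrite [LHS](_ : _ = (x j ^ y j)%g) // xj conj1g.
Qed.

Lemma subproduct_closed J : closed (subproduct J).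
Proof.
apply: box_closed => j; case: ifP => _; first exact: closedT.
by apply/accessible_closed_set1/hausdorff_accessible; have [[]] := pH j.
Qed.

Lemma subproduct_proj J j : `[< infinite_set (proj (subproduct J) j) >] = (j \in J).
Proof.
apply/asboolP/idP => [iP|jJ].
  apply: contrapT => nJ; apply: iP.
  apply: (@sub_finite_set _ _ [set 1%g]); last exact: finite_set1.
  by move=> _ [x /(_ j) + <-]; case: ifP.
apply: sub_infinite_set (@infinite_factor j) => h _.
exists (embed h); last by rewrite embedE.
move=> k; case: ifP => // kJ /=; rewrite embed_out //.
by apply: contraFN kJ => /eqP <-.
Qed.

Lemma dprod_factorE j : dprod_factor (H := H) j = subproduct [set j]%SET.
Proof.
apply/seteqP; split=> x Nx k.
  by rewrite finset.in_set1; case: eqVneq => // /eqP kj; exact: Nx.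
by move=> kj; have := Nx k; rewrite finset.in_set1; case: eqVneq.
Qed.

End Factors.

Arguments proj {I H} N j.

(** * The normal Hausdorff spectrum of the product *)

Theorem theorem1p7 (R : realType) (p r : nat) (H : 'I_r -> topGroupType)
    (p_prime : prime p) (r_gt0 : (0 < r)%N)
    (H_pro_p : forall j, pro_p p (H j))
    (H_fg : forall j, finitely_generated (H j))
    (H_RG : forall j, (0 < rank_gradient R (H j))%E) :
  let G : topGroupType := prod_topology H in
  let alpha := fun j : 'I_r => hdim R p (@frattini G p) (dprod_factor (H := H) j) in
  normal_hspec R p (@frattini G p) =
  range (fun J : {set 'I_r} => \sum_(j in J) alpha j).
Proof.
move=> G alpha.
have gx j := frattini_growth p_prime (H_pro_p j) (H_fg j) (H_RG j).
(* The limits [L j] of the shares are identified with the [alpha j] below, through the dimension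
   formula at singletons. *)
have /choice[L LP] := fun j => growth_share_cvg j gx.
have hdimN := hdim_normal p_prime H_pro_p H_fg H_RG _ LP.
have projE J j := subproduct_proj p_prime H_pro_p H_fg H_RG J j.
have hdimJ J : hdim R p (@frattini G p) (subproduct J) = \sum_(j in J) L j.
  rewrite hdimN; last exact: subproduct_normal.
  by apply: eq_bigl => j; rewrite projE.
have alphaE j : alpha j = L j.
  by rewrite /alpha dprod_factorE hdimJ big_set1.
have sumE (J : {set 'I_r}) : \sum_(j in J) alpha j = \sum_(j in J) L j.
  by apply: eq_bigr.
apply/seteqP; split=> [_ [N [cN nN] <-]|_ [J _ <-]].
  (* Only the factors with infinite projection of [N] contribute. *)
  exists [set j | `[< infinite_set (proj N j) >]]%SET => //.
  by rewrite sumE hdimN //; apply: eq_bigl => j; rewrite inE.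
exists (subproduct J); last by rewrite sumE hdimJ.
by split; [exact: subproduct_closed H_pro_p J | exact: subproduct_normal].
Qed.
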